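(* Let $K$ be a Lebesgue-negligible compact subset of the unit circle $\mathbb{T}$. Then there exists a Schur function $\psi\in A(\mathbb{D})$ such that $E_\psi = K$, $\psi(e^{i\theta}) = 1$ for all $e^{i\theta}\in K$, and, for some constants $a, b > 0$, $$a_n(C_\psi) \leq a\,\exp(-b\, n/\log n) \qquad \text{for all } n\geq 2.$$ In particular, $C_\psi\in\bigcap_{p>0} S_p$.
   Context: $\mathbb{D}$ is the open unit disk, $\mathbb{T}$ the unit circle, and $A(\mathbb{D})$ (the disk algebra) is the space of functions continuous on $\overline{\mathbb{D}}$ and analytic in $\mathbb{D}$. A Schur function is an analytic map $\psi:\mathbb{D}\to\mathbb{D}$; $C_\psi : H^2\to H^2$, $C_\psi(f) = f\circ\psi$, is the associated composition operator on the Hardy space $H^2$ of the disk (always bounded). $E_\psi = \{e^{i\theta} : |\psi^*(e^{i\theta})| = 1\}$, where $\psi^*$ denotes the boundary values of $\psi$ (equal to $\psi|_{\mathbb{T}}$ when $\psi\in A(\mathbb{D})$). The approximation numbers of a bounded operator $T$ are $a_n(T) = \inf\{\|T - R\| : \mathrm{rank}\,(R) < n\}$, $n=1,2,\ldots$, and $S_p$ is the Schatten class of operators $T$ on $H^2$ with $\sum_n a_n(T)^p < \infty$. *)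

(* Defs.v *)
From HB Require Import structures.
From mathcomp Require Import all_boot all_order all_algebra complex.
From mathcomp Require Import all_classical all_reals all_analysis.
From mathcomp Require Import ring.

Set Implicit Arguments.
Unset Strict Implicit.
Unset Printing Implicit Defensive.

Import Order.TTheory GRing.Theory Num.Theory.
Import numFieldNormedType.Exports.

Local Open Scope classical_set_scope.
Local Open Scope complex_scope.
Local Open Scope ring_scope.

(* [R[i]^o] is the copy of the complex field that carries its topology and its
   structure of normed space over itself. *)
Notation Cplx R := (R[i]^o).

Section Disk.
Variable R : realType.
Local Notation C := (Cplx R).

Definition disk : set C := [set z | `|z| < 1].
Definition closed_disk : set C := [set z | `|z| <= 1].
Definition circle : set C := [set z | `|z| = 1].

Definition cis (t : R) : C := cos t +i* sin t.

Definition circle_negligible (K : set C) : Prop :=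
  (@lebesgue_measure R).-negligible
    [set t | 0 <= t < 2 * pi /\ K (cis t)].

Definition analytic_on_disk (f : C -> C) : Prop :=
  forall z, disk z -> derivable f z 1.

(* Functions on the disk or on its closure are given by total functions
   [C -> C]; the values elsewhere are irrelevant. *)
Definition schur (psi : C -> C) : Prop :=
  analytic_on_disk psi /\ forall z, disk z -> disk (psi z).

Definition disk_algebra (f : C -> C) : Prop :=
  {within closed_disk, continuous f} /\ analytic_on_disk f.

(* Radial limit at a point [z] of the circle. *)
Definition boundary_value (f : C -> C) (z w : C) : Prop :=
  f (r%:C * z) @[r --> (1 : R)^'-] --> w.

Definition contact_set (psi : C -> C) : set C :=
  [set z | circle z /\ exists w, boundary_value psi z w /\ circle w].

End Disk.

Section Hardy.
Variable R : realType.
Local Notation C := (Cplx R).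

Definition taylor_expansion (f : C -> C) (a : nat -> C) : Prop :=
  forall z, disk z -> series (fun n => a n * z ^+ n) @ \oo --> f z.

Definition l2sum (a : nat -> C) : \bar R :=
  (\sum_(n <oo) (Normc.normc (a n) ^+ 2)%:E)%E.

(* The values outside the disk are normalised to 0, so that two elements of
   [hardy] are equal as soon as they agree on the disk. *)
Definition hardy : {pred (C -> C)} := fun f =>
  `[< (forall z, ~ disk z -> f z = 0) /\
      exists2 a, taylor_expansion f a & (l2sum a < +oo)%E >].

Lemma l2sumD (c : C) a b : (l2sum a < +oo)%E -> (l2sum b < +oo)%E ->
  (l2sum (fun n => (c * a n + b n)%R) < +oo)%E.
Proof.
move=> la lb.
have nneg (x : nat -> C) n : (0 <= (Normc.normc (x n) ^+ 2)%:E)%E.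
  by rewrite lee_fin sqr_ge0.
have n0 (x : C) : 0 <= Normc.normc x.
  by case: x => u v; rewrite /= sqrtr_ge0.
pose k := 2 * Normc.normc c ^+ 2.
have k0 : 0 <= k by rewrite mulr_ge0// sqr_ge0.
have : (k%:E * l2sum a + 2%:E * l2sum b < +oo)%E.
  by rewrite lte_add_pinfty ?lte_mul_pinfty// ?lee_fin// ?nneseries_ge0//.
apply: le_lt_trans; rewrite /l2sum -!nneseriesZl// -nneseriesD//; last 2 first.
- by move=> n _ _; rewrite mule_ge0.
- by move=> n _ _; rewrite mule_ge0.
apply: lee_nneseries => [n _ _|n _]; first by rewrite lee_fin sqr_ge0.
rewrite -!EFinM -EFinD lee_fin.
have := le_normcD (c * a n) (b n); rewrite Normc.normcM => h.
set u := Normc.normc (a n); set v := Normc.normc (b n).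
set w := Normc.normc c.
have h2 : (Normc.normc (c * a n + b n)) ^+ 2 <= (w * u + v) ^+ 2.
  by rewrite ler_sqr ?nnegrE ?n0// addr_ge0 ?mulr_ge0 ?n0.
apply: (le_trans h2); rewrite -subr_ge0.
rewrite (_ : _ - _ = (w * u - v) ^+ 2) ?sqr_ge0//.
by rewrite /k -/u -/v -/w; ring.
Qed.

Lemma hardy_submod_closed : submod_closed hardy.
Proof.
split=> [|c f g]; rewrite !unfold_in => /=.
  apply/asboolP; split=> //; exists (fun=> 0) => [z _|].
    rewrite (_ : series _ = fun=> 0); first exact: cvg_cst.
    by apply/funext => n; rewrite /series/= big1// => i _; rewrite mul0r.
  by rewrite /l2sum eseries0// => n _ _; rewrite Normc.normc0 expr0n.
move=> /asboolP[f0 [a fa la]] /asboolP[g0 [b gb lb]]; apply/asboolP.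
split=> [z zD|]; first by rewrite /= !fctE f0// g0// scaler0 addr0.
exists (fun n => c * a n + b n) => [z zD|]; last exact: l2sumD.
rewrite (_ : series _ = c *: series (fun n => a n * z ^+ n) +
                        series (fun n => b n * z ^+ n)).
  by apply: cvgD; [apply: cvgZr; exact: fa | exact: gb].
apply/funext => n; rewrite /series/= !fctE/= scaler_sumr -big_split/=.
by apply: eq_bigr => i _; rewrite mulrDl -mulrA.
Qed.

HB.instance Definition _ := GRing.isSubmodClosed.Build _ _ hardy
  hardy_submod_closed.

Record H2 := HardyFun { hardy_fun :> C -> C; _ : hardy_fun \in hardy }.

HB.instance Definition _ := [isSub for hardy_fun].
HB.instance Definition _ := [Choice of H2 by <:].
HB.instance Definition _ := [SubChoice_isSubLmodule of H2 by <:].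

(* The expansion exists by membership in [hardy] and is unique by the identity
   principle for power series. *)
Definition taylor_coef (f : H2) : nat -> C :=
  xget (fun=> 0) [set a | taylor_expansion f a].

Definition hnorm (f : H2) : R := Num.sqrt (fine (l2sum (taylor_coef f))).

End Hardy.

Section Operators.
Variable R : realType.
Local Notation C := (Cplx R).
Local Notation H2 := (H2 R).

Definition opnorm (T : H2 -> H2) : \bar R :=
  ereal_sup [set (hnorm (T f))%:E | f in [set f | hnorm f <= 1]].

Definition bounded_operator (T : H2 -> H2) : Prop := (opnorm T < +oo)%E.

Definition rank_lt (n : nat) (S : H2 -> H2) : Prop :=
  exists k, (k < n)%N /\ exists e : 'I_k -> H2,
    forall f, exists c : 'I_k -> R[i], S f = \sum_(i < k) c i *: e i.

(* Meaningful for [n >= 1]: there is no operator of rank < 0. *)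
Definition approximation_number (n : nat) (T : H2 -> H2) : \bar R :=
  ereal_inf [set opnorm (fun f => T f - S f) |
    S in [set S : {linear H2 -> H2} | bounded_operator S /\ rank_lt n S]].

Definition schatten (p : R) (T : H2 -> H2) : Prop :=
  (\sum_(1 <= n <oo) poweR (approximation_number n T) p < +oo)%E.

Definition is_composition_operator (psi : C -> C) (T : H2 -> H2) : Prop :=
  forall f z, disk z -> T f z = f (psi z).

End Operators.

(* Main.v *)
Require Import Defs.
From HB Require Import structures.
From mathcomp Require Import all_boot all_order all_algebra complex.
From mathcomp Require Import all_classical all_reals all_analysis.
From mathcomp Require Import cyclic separable cyclotomic finmap.
From mathcomp Require Import ring lra zify.

Import Order.TTheory GRing.Theory Num.Theory.
Import numFieldNormedType.Exports.

Set Implicit Arguments.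
Unset Strict Implicit.
Unset Printing Implicit Defensive.

Local Open Scope classical_set_scope.
Local Open Scope complex_scope.
Local Open Scope ring_scope.

(** The idea is to find an analytic function [G] on the disk with real part at
    least 1, continuous on the closed disk away from [K] and tending to
    infinity at the points of [K], and to follow it by a conformal map of the
    half plane onto a cusp with vertex 1: the deeper the values of the symbol
    go into the cusp, the rarer they are.

    The function [G] is Fatou's ([peak_function]). As [K] is compact and null,
    it has finite covers by balls centred in [K] whose radii have a small sum;
    to each ball of centre [c] and radius [e] is attached the function
    [e / (1 + e - c^* z)], which has positive real part, at least 1/2 on the
    ball, and modulus at most [e / |z - c|]. Summing over a sequence of covers
    gives [G - 1]. The conformal map is replaced by an explicit series: with
    [t j] the function [G / (2 ^+ j + G)], the sum of the [t j] behaves as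
    the logarithm of [G]; its real part is at least 0, tends to infinity with
    [G], and its imaginary part is bounded ([Im_logsum1_le]). Adding 1 gives
    the height [L], with values in a half strip, and the symbol is
    [psi = 1 - 1 / L], extended by 1 on [K]. One has
    [1 / (1 - |psi|^2) <= 17 Re L].

    All estimates of operators rest on [harmonic_majorant]: if
    [|h|^2 <= Re s] on the disk with [s] analytic, then [h] is in the Hardy
    space and its squared norm is at most [Re (s 0)]. Together with the bound
    of point evaluations, this controls [f |-> beta (f \o psi)] by any
    harmonic majorant of [|beta|^2 / (1 - |psi|^2)]
    ([weighted_composition]). With [beta = 1] and the majorant [17 L], the
    composition operator is bounded.

    For the approximation numbers, dividing [f] successively by Blaschke
    factors ([blaschke_division]) splits it into an element of a space of
    dimension [N] and a product [B g] with [B] a Blaschke product of degree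
    [N] and [g] of norm at most that of [f]. Thus [|B (psi)|^2 / (1 - |psi|^2)]
    is to be majorised. In terms of the height, the Blaschke factor with zero
    [1 - 1 / t] is [(L - t) / (L + t - 1)], of modulus bounded away from 1
    when [Re L] is between [t] and [2 t]. Zeros of order [m], about
    [n / log n], at the points [1 - 2 ^- i] for [i] up to [log n], hence make
    [B (psi)] exponentially small in [m] where [Re L <= n]. Where
    [Re L > n], many of the [t j] have a substantial real part, so that
    the sum of the [(3 / 2) ^+ j * t j] is exponentially large in [n]
    ([Re_logsum1_le]). A small multiple of this sum, whose value at 0 is a
    constant, is the required majorant there.

    Analytic functions are handled as locally uniform limits of polynomials
    ([hol]). This makes the stability properties elementary, and the passage
    to Taylor coefficients rests on Parseval's identity for polynomials
    sampled at roots of unity. *)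

(** * Complex numbers and geometrically convergent series *)

Section ComplexNorm.
Variable R : realType.
Local Notation C := (Cplx R).
Local Notation nrm := (@Normc.normc R).
Implicit Types (x y z : C) (u v : nat -> C).

Lemma nrmE x : `|x| = (nrm x)%:C :> R[i].
Proof. by rewrite normc_def; case: x. Qed.

Lemma nrm_ge0 x : 0 <= nrm x.
Proof. exact: (normr_ge0 (x : Rcomplex R)). Qed.

Lemma nrmD x y : nrm (x + y) <= nrm x + nrm y.
Proof. exact: (ler_normD (x : Rcomplex R) y). Qed.

Lemma nrmN x : nrm (- x) = nrm x.
Proof. exact: (normrN (x : Rcomplex R)). Qed.

Lemma nrmB x y : nrm (x - y) <= nrm x + nrm y.
Proof. exact: (ler_normB (x : Rcomplex R) y). Qed.

Lemma nrmBC x y : nrm (x - y) = nrm (y - x).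
Proof. exact: (distrC (x : Rcomplex R) y). Qed.

Lemma nrm_distD z x y : nrm (x - y) <= nrm (x - z) + nrm (z - y).
Proof. exact: (ler_distD (z : Rcomplex R) x y). Qed.

Lemma nrm_sub_ge x y : nrm x - nrm y <= nrm (x - y).
Proof. exact: (lerB_dist (x : Rcomplex R) y). Qed.

Lemma nrm_sum (I : Type) (r : seq I) (P : pred I) (F : I -> C) :
  nrm (\sum_(i <- r | P i) F i) <= \sum_(i <- r | P i) nrm (F i).
Proof.
elim/big_ind2: _ => [|x a y b xa yb|//]; first by rewrite Normc.normc0.
exact: le_trans (nrmD _ _) (lerD xa yb).
Qed.

Lemma nrm0 : nrm 0 = 0. Proof. exact: Normc.normc0. Qed.

Lemma nrm1 : nrm 1 = 1. Proof. exact: Normc.normc1. Qed.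

Lemma nrmM x y : nrm (x * y) = nrm x * nrm y.
Proof. exact: Normc.normcM. Qed.

Lemma nrmV x : nrm x^-1 = (nrm x)^-1.
Proof. exact: Normc.normcV. Qed.

Lemma nrmX x n : nrm (x ^+ n) = nrm x ^+ n.
Proof. by elim: n => [|n ih]; rewrite ?nrm1// !exprS nrmM ih. Qed.

Lemma nrm_real (r : R) : nrm r%:C = `|r|.
Proof. by rewrite /= expr0n addr0 sqrtr_sqr. Qed.

Lemma nrm_real_ge0 (r : R) : 0 <= r -> nrm r%:C = r.
Proof. by move=> r0; rewrite nrm_real ger0_norm. Qed.

Lemma nrm_sqr x : nrm x ^+ 2 = complex.Re x ^+ 2 + complex.Im x ^+ 2.
Proof. by case: x => a b; rewrite /= sqr_sqrtr// addr_ge0// sqr_ge0. Qed.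

Lemma nrm_conj x : nrm x^*%C = nrm x.
Proof. by case: x => a b /=; rewrite sqrrN. Qed.

Lemma nrm_eq0 x : (nrm x == 0) = (x == 0).
Proof. exact: (normr_eq0 (x : Rcomplex R)). Qed.

Lemma nrm_gt0 x : (0 < nrm x) = (x != 0).
Proof. exact: (normr_gt0 (x : Rcomplex R)). Qed.

Lemma ReD x y : complex.Re (x + y) = complex.Re x + complex.Re y.
Proof. by case: x y => ? ? []. Qed.

Lemma ImD x y : complex.Im (x + y) = complex.Im x + complex.Im y.
Proof. by case: x y => ? ? []. Qed.

Lemma ReN x : complex.Re (- x) = - complex.Re x.
Proof. by case: x. Qed.

Lemma ImN x : complex.Im (- x) = - complex.Im x.
Proof. by case: x. Qed.

Lemma ReB x y : complex.Re (x - y) = complex.Re x - complex.Re y.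
Proof. by rewrite ReD ReN. Qed.

Lemma ReZ (r : R) x : complex.Re (r%:C * x) = r * complex.Re x.
Proof. by case: x => a b /=; rewrite mul0r subr0. Qed.

Lemma ImZ (r : R) x : complex.Im (r%:C * x) = r * complex.Im x.
Proof. by case: x => a b /=; rewrite mul0r addr0. Qed.

Lemma Re_sum (I : Type) (r : seq I) (P : pred I) (F : I -> C) :
  complex.Re (\sum_(i <- r | P i) F i) = \sum_(i <- r | P i) complex.Re (F i).
Proof. exact: (big_morph (@complex.Re R) ReD). Qed.

Lemma Im_sum (I : Type) (r : seq I) (P : pred I) (F : I -> C) :
  complex.Im (\sum_(i <- r | P i) F i) = \sum_(i <- r | P i) complex.Im (F i).
Proof. exact: (big_morph (@complex.Im R) ImD). Qed.

Lemma Re_le_nrm x : `|complex.Re x| <= nrm x.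
Proof. by rewrite -lecR -nrmE normc_ge_Re. Qed.

Lemma Im_le_nrm x : `|complex.Im x| <= nrm x.
Proof.
rewrite -(@ler_pXn2r _ 2)// ?nnegrE ?nrm_ge0// nrm_sqr real_normK ?num_real//.
by rewrite lerDr sqr_ge0.
Qed.

Lemma nrm_le_ReIm x : nrm x <= `|complex.Re x| + `|complex.Im x|.
Proof.
rewrite -(@ler_pXn2r _ 2)// ?nnegrE ?nrm_ge0 ?addr_ge0// nrm_sqr.
by rewrite sqrrD !real_normK ?num_real// addrAC lerDl mulrn_wge0 ?mulr_ge0.
Qed.

(** The norm of [C] is complex valued, so its balls are indexed by positive
    complex numbers; this lemma turns neighbourhoods into real estimates. *)
Lemma nbhs_nrmP x (A : set C) :
  nbhs x A <-> exists2 e : R, 0 < e & forall y, nrm (y - x) < e -> A y.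
Proof.
split=> [/nbhs_ballP[e /= e0 xeA]|[e e0 xeA]].
  exists (complex.Re e); first by move: e0; rewrite ltcE => /andP[].
  move=> y yx; apply: xeA; rewrite -ball_normE /ball_/= nrmE nrmBC.
  by rewrite ltcE/= yx andbT; move: e0; rewrite ltcE => /andP[].
apply/nbhs_ballP; exists e%:C; rewrite /= ?ltcR// => y.
by rewrite -ball_normE /ball_/= nrmE ltcR nrmBC => /xeA.
Qed.

Lemma cvgC_nrm (T : Type) (F : set_system T) {FF : Filter F} (f : T -> C) x :
  f @ F --> x <-> nrm (f t - x) @[t --> F] --> (0 : R).
Proof.
split=> [fx|fx].
  apply/cvgrPdist_lt => e e0.
  have /fx : nbhs x [set y | nrm (y - x) < e] by apply/nbhs_nrmP; exists e.
  move=> fe; near=> t; rewrite /=.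
  have : nrm (f t - x) < e by near: t.
  by rewrite sub0r normrN ger0_norm// nrm_ge0.
move=> A /nbhs_nrmP[e e0 xeA].
move/cvgrPdist_lt : fx => /(_ _ e0) fe; near=> t; apply: xeA.
rewrite -[ltLHS]ger0_norm ?nrm_ge0// -normrN -sub0r; near: t; exact: fe.
Unshelve. all: by end_near.
Qed.

Lemma cvg_seqC u x : (u @ \oo --> x) <->
  forall e : R, 0 < e -> exists N, forall n, (N <= n)%N -> nrm (u n - x) <= e.
Proof.
rewrite cvgC_nrm; split=> [ux e e0|ux].
  move/cvgrPdist_le : ux => /(_ _ e0)[N _ uN]; exists N => n /uN.
  by rewrite /= sub0r normrN ger0_norm ?nrm_ge0.
apply/cvgrPdist_le => e e0; have [N uN] := ux _ e0; exists N => // n /uN /=.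
by rewrite sub0r normrN ger0_norm ?nrm_ge0.
Qed.

Lemma cvgC_unique u x y : u @ \oo --> x -> u @ \oo --> y -> x = y.
Proof.
move=> /cvg_seqC ux /cvg_seqC uy; apply/eqP; rewrite -subr_eq0 -nrm_eq0.
apply/eqP/le_anti; rewrite nrm_ge0 andbT; apply/ler_addgt0Pr => e e0.
have e20 : 0 < e / 2 by rewrite divr_gt0.
have [[N hN] [M hM]] := (ux _ e20, uy _ e20); rewrite add0r.
rewrite (le_trans (nrm_distD (u (maxn N M)) _ _))// [leRHS]splitr lerD//.
  by rewrite nrmBC hN// leq_maxl.
by rewrite hM// leq_maxr.
Qed.

Lemma cvgC_Re u x : u @ \oo --> x ->
  complex.Re (u n) @[n --> \oo] --> complex.Re x.
Proof.
move=> /cvg_seqC ux; apply/cvgrPdist_le => e e0.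
have [N uN] := ux _ e0; exists N => // n /uN /=; apply: le_trans.
by rewrite -ReB (le_trans (Re_le_nrm _))// nrmBC.
Qed.

Lemma cvgC_Im u x : u @ \oo --> x ->
  complex.Im (u n) @[n --> \oo] --> complex.Im x.
Proof.
move=> /cvg_seqC ux; apply/cvgrPdist_le => e e0.
have [N uN] := ux _ e0; exists N => // n /uN /=; apply: le_trans.
by rewrite -ImN -ImD (le_trans (Im_le_nrm _))// nrmBC.
Qed.

Lemma cvgC_norm u x : u @ \oo --> x -> nrm (u n) @[n --> \oo] --> nrm x.
Proof.
move=> /cvg_seqC ux; apply/cvgrPdist_le => e e0.
have [N uN] := ux _ e0; exists N => // n /uN /=; apply: le_trans.
rewrite nrmBC; exact: (ler_dist_dist (x : Rcomplex R) (u n)).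
Qed.

End ComplexNorm.

Section GeometricSeries.
Variable R : realType.
Local Notation C := (Cplx R).
Local Notation nrm := (@Normc.normc R).
Implicit Types (x y z : C) (u v : nat -> C).

Definition csum u : C := lim (series u @ \oo).

Lemma csum_eq u l : series u @ \oo --> l -> csum u = l.
Proof.
move=> ul; apply: (cvgC_unique _ ul).
by have := cvgP _ ul.
Qed.

(** The form of the M-test used for all series of functions below: they are
    dominated by geometric series whose constants are uniform on the region
    of interest, and so are their remainders. *)
Lemma geometric_domination u (M q : R) : 0 <= q < 1 ->
    (forall n, nrm (u n) <= M * q ^+ n) ->
  series u @ \oo --> csum u /\
  forall n, nrm (csum u - series u n) <= M * q ^+ n / (1 - q).
Proof.
move=> /andP[q0 q1] uM.
have M0 : 0 <= M by have := uM 0%N; rewrite expr0 mulr1; apply: le_trans; exact: nrm_ge0.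
have gq : cvgn (series (geometric M q)).
  by apply: is_cvg_geometric_series; rewrite ger0_norm.
have cvg_part (f : C -> R) : (forall x, `|f x| <= nrm x) ->
    cvgn (series (f \o u)).
  move=> fle; apply: normed_cvg; apply: (series_le_cvg _ _ _ gq) => n /=.
  - exact: normr_ge0.
  - by rewrite mulr_ge0// exprn_ge0.
  - exact: le_trans (fle _) (uM n).
have /cvg_ex[a ua] := cvg_part _ (@Re_le_nrm R).
have /cvg_ex[b ub] := cvg_part _ (@Im_le_nrm R).
have ul : series u @ \oo --> (a +i* b : C).
  apply/cvg_seqC => e e0; have e20 : 0 < e / 2 by rewrite divr_gt0.
  move/cvgrPdist_le : ua => /(_ _ e20)[N1 _ h1].
  move/cvgrPdist_le : ub => /(_ _ e20)[N2 _ h2].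
  exists (maxn N1 N2) => n; rewrite geq_max => /andP[n1 n2].
  rewrite nrmBC (le_trans (nrm_le_ReIm _))// [e]splitr lerD//.
    have := h1 _ n1; rewrite /= /series /= => h.
    by rewrite ReB Re_sum.
  have := h2 _ n2; rewrite /= /series /= => h.
  by rewrite ImD ImN Im_sum.
have csumE := csum_eq ul; rewrite csumE; split => // n.
apply/ler_addgt0Pr => e e0.
have [N hN] := (cvg_seqC _ _).1 ul _ e0.
pose m := maxn N n.
have nm : (n <= m)%N by rewrite leq_maxr.
rewrite [leRHS]addrC (le_trans (nrm_distD (series u m) _ _))// lerD//.
  by rewrite nrmBC hN// leq_maxl.
rewrite /series/= -(subnKC nm) /index_iota !subn0 iotaD big_cat/=.
rewrite [X in Normc.normc X]addrC addKr (le_trans (nrm_sum _ _ _))//.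
apply: (@le_trans _ _ (\sum_(i <- iota n (m - n)) M * q ^+ i)).
  by apply: ler_sum => i _; exact: uM.
rewrite -[n in iota n]addn0 iotaDl big_map -mulr_sumr -mulrA ler_wpM2l//.
under eq_bigr do rewrite exprD.
rewrite -mulr_sumr ler_wpM2l ?exprn_ge0//.
have q1' : 0 < 1 - q by rewrite subr_gt0.
rewrite -(ler_pM2r q1') mulVf ?gt_eqF// mulrC.
have -> : iota 0 (m - n) = index_iota 0 (m - n) by rewrite /index_iota subn0.
rewrite big_mkord -opprB mulNr -subrX1 opprB gerBl.
by rewrite exprn_ge0.
Qed.

End GeometricSeries.

(** * Parseval's identity over roots of unity *)

Section RootsOfUnity.
Variable R : realType.
Local Notation C := (Cplx R).
Local Notation nrm := (@Normc.normc R).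
Implicit Types (p : {poly R[i]}) (N : nat) (w : R[i]).

Lemma primitive_root_exists N : (0 < N)%N ->
  exists w : R[i], N.-primitive_root w.
Proof.
pose p : {poly R[i]} := 'X^N - 1.
have [r Dp] := closed_field_poly_normal p.
move=> N0; rewrite (monicP _) ?monicXnsubC// scale1r in Dp.
have rN1 : all N.-unity_root r by apply/allP => z; rewrite -root_prod_XsubC -Dp.
have sz_r : (N < (size r).+1)%N.
  by rewrite -(size_prod_XsubC r id) -Dp size_XnsubC.
have [|w _ pw] := hasP (has_prim_root N0 rN1 _ sz_r); last by exists w.
by rewrite -separable_prod_XsubC -Dp separable_Xn_sub_1// pnatr_eq0 -lt0n.
Qed.

Lemma nrm_primitive_root N w : N.-primitive_root w -> nrm w = 1.
Proof.
move=> pw; have N0 := prim_order_gt0 pw.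
apply/eqP; rewrite -(@pexpr_eq1 _ _ N)// ?nrm_ge0//.
by rewrite -nrmX prim_expr_order// nrm1.
Qed.

Lemma mul_conj_nrm (x : R[i]) : x * x^*%C = ((nrm x) ^+ 2)%:C.
Proof. by rewrite -sqr_normc nrmE rmorphXn. Qed.

Lemma primitive_root_orthogonality N w k l : N.-primitive_root w ->
    (k < N)%N -> (l < N)%N ->
  \sum_(j < N) (w ^+ j) ^+ k * ((w ^+ j) ^+ l)^*%C = ((k == l) * N)%:R.
Proof.
move=> pw kN lN; set y := w ^+ k * (w ^+ l)^*%C.
have wl1 : w ^+ l * (w ^+ l)^*%C = 1.
  by rewrite mul_conj_nrm nrmX (nrm_primitive_root pw) !expr1n.
under eq_bigr => j _.
  rewrite -!exprM ![(j * _)%N]mulnC !exprM rmorphXn -exprMn -/y; over.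
have [kl|kl] := eqVneq k l.
  rewrite mul1n /y kl wl1; under eq_bigr do rewrite expr1n.
  by rewrite sumr_const card_ord.
rewrite mul0n; have y1 : y - 1 != 0.
  rewrite subr_eq0; apply: contra kl => /eqP y1.
  have : w ^+ k = w ^+ l.
    by rewrite -[RHS]mul1r -y1 /y -mulrA [X in _ * X]mulrC wl1 mulr1.
  by move/eqP; rewrite (eq_prim_root_expr pw) !modn_small.
apply/eqP; rewrite -(mulrI_eq0 _ (lregP y1)) -subrX1.
rewrite /y exprMn -rmorphXn/= -!exprM mulnC exprM (mulnC l) exprM.
by rewrite (prim_expr_order pw) !expr1n rmorph1 mulr1 subrr.
Qed.

Lemma poly_horner_lt p N (z : R[i]) : (size p <= N)%N ->
  p.[z] = \sum_(k < N) p`_k * z ^+ k.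
Proof.
move=> pN; rewrite horner_coef (big_ord_widen _ (fun k => p`_k * z ^+ k) pN).
rewrite [in RHS](bigID (fun k : 'I_N => (k < size p)%N))/=.
rewrite [X in _ = _ + X]big1 ?addr0// => k; rewrite -leqNgt => pk.
by rewrite nth_default// mul0r.
Qed.

(** Exact rather than asymptotic: a polynomial of degree less than [N] suffers
    no aliasing when it is sampled at the [N]-th roots of unity. *)
Lemma poly_parseval p N w (r : R) : N.-primitive_root w -> (size p <= N)%N ->
  \sum_(j < N) nrm p.[r%:C * w ^+ j] ^+ 2 =
  N%:R * \sum_(k < N) (nrm p`_k * r ^+ k) ^+ 2.
Proof.
move=> pw pN; apply: complexI; rewrite rmorph_sum rmorphM rmorph_sum/=.
under eq_bigr => j _.
  rewrite -mul_conj_nrm (poly_horner_lt _ pN) rmorph_sum mulr_suml/=.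
  under eq_bigr do rewrite mulr_sumr.
  over.
rewrite exchange_big/= mulr_sumr; apply: eq_bigr => k _.
rewrite exchange_big/= (bigD1 k)//= [X in _ + X]big1 ?addr0 => [|l lk].
  under eq_bigr => j _.
    rewrite !rmorphM !exprMn rmorphM/= mulrACA.
    rewrite [X in _ * X]mulrACA; over.
  rewrite -!mulr_sumr (primitive_root_orthogonality pw)// eqxx mul1n.
  rewrite !mul_conj_nrm nrmX nrm_real -(rmorph_nat (real_complex R)) -!rmorphM/=.
  rewrite !exprMn -!exprM -normrX ger0_norm; last by rewrite exprM exprn_even_ge0.
  by congr (_%:C); rewrite [RHS]mulrC mulrA.
under eq_bigr => j _.
  rewrite !rmorphM !exprMn rmorphM/= mulrACA.
  rewrite [X in _ * X]mulrACA; over.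
rewrite -!mulr_sumr (primitive_root_orthogonality pw)//.
by rewrite eq_sym (negbTE lk : (l == k :> nat) = false) mul0n !mulr0.
Qed.

Lemma poly_mean p N w (r : R) : N.-primitive_root w -> (size p <= N)%N ->
  \sum_(j < N) p.[r%:C * w ^+ j] = N%:R * p`_0.
Proof.
move=> pw pN; have N0 := prim_order_gt0 pw.
under eq_bigr do rewrite (poly_horner_lt _ pN).
rewrite exchange_big/= (bigD1 (Ordinal N0))//= [X in _ + X]big1 ?addr0.
  under eq_bigr do rewrite expr0 mulr1.
  by rewrite sumr_const card_ord mulr_natl.
move=> k k0; under eq_bigr do rewrite exprMn.
rewrite -!mulr_sumr.
have := primitive_root_orthogonality pw (ltn_ord k) N0.
rewrite (negbTE k0 : (k == 0 :> nat) = false) mul0n => h.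
rewrite (eq_bigr (fun j : 'I_N => (w ^+ j) ^+ k * ((w ^+ j) ^+ 0)^*%C)).
  by rewrite h !mulr0.
by move=> j _; rewrite expr0 conjc1 mulr1.
Qed.

(** A single term of Parseval's sum is at most the mean of [|p|^2]. *)
Lemma poly_cauchy_estimate p (r M : R) k : 0 <= r -> 0 <= M ->
    (forall z, nrm z = r -> nrm p.[z] <= M) ->
  nrm p`_k * r ^+ k <= M.
Proof.
move=> r0 M0 pM; pose N := maxn (size p) k.+1.
have kN : (k < N)%N by rewrite leq_maxr.
have N0 : (0 < N)%N by apply: leq_ltn_trans kN.
have [w pw] := primitive_root_exists N0.
rewrite -(@ler_pXn2r _ 2)// ?nnegrE ?mulr_ge0 ?exprn_ge0 ?nrm_ge0//.
have NR : 0 < N%:R :> R by rewrite ltr0n.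
rewrite -(ler_pM2l NR).
apply: (@le_trans _ _ (N%:R * \sum_(k < N) (nrm p`_k * r ^+ k) ^+ 2)).
  rewrite ler_pM2l// (bigD1 (Ordinal kN))//= lerDl sumr_ge0// => i _.
  exact: sqr_ge0.
rewrite -(poly_parseval _ pw) ?leq_maxl//.
apply: (@le_trans _ _ (\sum_(j < N) M ^+ 2)); last first.
  by rewrite sumr_const card_ord mulr_natl.
apply: ler_sum => j _; rewrite ler_pXn2r// ?nnegrE ?nrm_ge0//.
by apply: pM; rewrite nrmM nrm_real_ge0// nrmX (nrm_primitive_root pw) expr1n mulr1.
Qed.

End RootsOfUnity.

(** * Locally uniform limits of polynomials *)

Section HolomorphicOnDisk.
Variable R : realType.
Local Notation C := (Cplx R).
Local Notation nrm := (@Normc.normc R).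
Implicit Types (f g h : C -> C) (z c : C) (r e : R) (p : {poly R[i]}).

(** Analyticity on the disk, in Runge's form. Stability under sums, products,
    inverses, composition and locally uniform limits is then elementary, with
    no recourse to contour integrals. *)
Definition hol f := forall r e, r < 1 -> 0 < e ->
  exists p, forall z, nrm z <= r -> nrm (f z - p.[z]) <= e.

Lemma nrm_poly_le p z : nrm z <= 1 -> nrm p.[z] <= \sum_(i < size p) nrm p`_i.
Proof.
move=> z1; rewrite horner_coef (le_trans (nrm_sum _ _ _))// ler_sum// => i _.
by rewrite nrmM nrmX ler_piMr ?nrm_ge0// exprn_ile1// nrm_ge0.
Qed.

Lemma hol_bounded f r : hol f -> r < 1 ->
  exists2 M, 0 < M & forall z, nrm z <= r -> nrm (f z) <= M.
Proof.
move=> hf r1; have [p hp] := hf _ _ r1 ltr01.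
exists (1 + \sum_(i < size p) nrm p`_i).
  by rewrite ltr_pwDl// sumr_ge0// => i _; rewrite nrm_ge0.
move=> z zr; rewrite -[f z](subrK p.[z]) (le_trans (nrmD _ _))// lerD ?hp//.
by rewrite nrm_poly_le// (le_trans zr)// ltW.
Qed.

Lemma hol_poly p : hol (horner p).
Proof. by move=> r e r1 e0; exists p => z _; rewrite subrr nrm0 ltW. Qed.

Lemma hol_eq f g : (forall z, nrm z < 1 -> f z = g z) -> hol f -> hol g.
Proof.
move=> fg hf r e r1 e0; have [p hp] := hf _ _ r1 e0; exists p => z zr.
by rewrite -fg ?hp// (le_lt_trans zr).
Qed.

Lemma hol_cst c : hol (fun=> c).
Proof. by apply: hol_eq (hol_poly c%:P) => z _; rewrite hornerC. Qed.

Lemma hol_id : hol id.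
Proof. by apply: hol_eq (hol_poly 'X) => z _; rewrite hornerX. Qed.

Lemma holD f g : hol f -> hol g -> hol (fun z => f z + g z).
Proof.
move=> hf hg r e r1 e0; have e20 : 0 < e / 2 by rewrite divr_gt0.
have [[p hp] [q hq]] := (hf _ _ r1 e20, hg _ _ r1 e20).
exists (p + q) => z zr; rewrite hornerD opprD addrACA [e]splitr.
by rewrite (le_trans (nrmD _ _))// lerD ?hp ?hq.
Qed.

Lemma holM f g : hol f -> hol g -> hol (fun z => f z * g z).
Proof.
move=> hf hg r e r1 e0.
have [M M0 fM] := hol_bounded hf r1; have [N N0 gN] := hol_bounded hg r1.
have d0 : 0 < e / 2 / (N + 1) by rewrite !divr_gt0// addr_gt0.
have d'0 : 0 < Num.min 1 (e / 2 / M) by rewrite lt_min ltr01/= !divr_gt0.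
have [[p hp] [q hq]] := (hf _ _ r1 d0, hg _ _ r1 d'0).
exists (p * q) => z zr; rewrite hornerM.
rewrite (_ : _ - _ = f z * (g z - q.[z]) + q.[z] * (f z - p.[z])); last by ring.
have qN : nrm q.[z] <= N + 1.
  rewrite -[q.[z]](subKr (g z)) (le_trans (nrmB _ _))// lerD ?gN//.
  by rewrite (le_trans (hq _ zr))// ge_min lexx.
rewrite (le_trans (nrmD _ _))// !nrmM [leRHS]splitr lerD//.
  apply: (@le_trans _ _ (M * (e / 2 / M))).
    by rewrite ler_pM ?nrm_ge0 ?fM// (le_trans (hq _ zr))// ge_min lexx orbT.
  by rewrite mulrC divfK// gt_eqF.
apply: (@le_trans _ _ ((N + 1) * (e / 2 / (N + 1)))).
  by rewrite ler_pM ?nrm_ge0 ?hp.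
by rewrite mulrC divfK// gt_eqF// addr_gt0.
Qed.

Lemma holZ c f : hol f -> hol (fun z => c * f z).
Proof. by move=> hf; apply: holM => //; exact: hol_cst. Qed.

Lemma holB f g : hol f -> hol g -> hol (fun z => f z - g z).
Proof.
move=> hf hg; apply: hol_eq (holD hf (holZ (-1) hg)) => z _.
by rewrite mulN1r.
Qed.

Lemma holX f n : hol f -> hol (fun z => f z ^+ n).
Proof.
move=> hf; elim: n => [|n ih]; first exact: hol_cst.
by apply: hol_eq (holM hf ih) => z _; rewrite exprS.
Qed.

Lemma hol_sum (I : Type) (s : seq I) (f : I -> C -> C) :
  (forall i, hol (f i)) -> hol (fun z => \sum_(i <- s) f i z).
Proof.
move=> hf; elim: s => [|i s ih].
  by apply: hol_eq (hol_cst 0) => z _; rewrite big_nil.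
by apply: hol_eq (holD (hf i) ih) => z _; rewrite big_cons.
Qed.

Lemma hol_of_local_uniform f :
    (forall r e, r < 1 -> 0 < e ->
      exists2 g, hol g & forall z, nrm z <= r -> nrm (f z - g z) <= e) ->
  hol f.
Proof.
move=> hf r e r1 e0; have e20 : 0 < e / 2 by rewrite divr_gt0.
have [g hg fg] := hf _ _ r1 e20; have [p hp] := hg _ _ r1 e20.
exists p => z zr; rewrite (le_trans (nrm_distD (g z) _ _))// [leRHS]splitr.
by rewrite lerD ?fg ?hp.
Qed.

Lemma geometric_small (M q e : R) : 0 <= q < 1 -> 0 < e ->
  exists N, forall n, (N <= n)%N -> M * q ^+ n <= e.
Proof.
move=> /andP[q0 q1] e0.
have := @cvg_geometric R M q; rewrite ger0_norm// => /(_ q1).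
move/cvgrPdist_le => /(_ _ e0)[N _ h]; exists N => n /h /=.
rewrite sub0r normrN; exact: le_trans (ler_norm _).
Qed.

Lemma hol_csum (u : nat -> C -> C) : (forall j, hol (u j)) ->
    (forall r, 0 <= r < 1 -> exists M, exists2 q, 0 <= q < 1 &
      forall j z, nrm z <= r -> nrm (u j z) <= M * q ^+ j) ->
  hol (fun z => csum (u^~ z)).
Proof.
move=> hu uM; apply: hol_of_local_uniform => r e r1 e0.
have r01 : 0 <= Num.max 0 r < 1 by rewrite le_max lexx/= gt_max ltr01.
have [M [q q01 hM]] := uM _ r01.
have [n hn] := @geometric_small (M / (1 - q)) _ _ q01 e0.
exists (fun z => series (u^~ z) n); first exact: hol_sum.
move=> z zr.
have zr' : nrm z <= Num.max 0 r by rewrite le_max zr orbT.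
have [_ h] := geometric_domination q01 (fun j => hM j z zr').
by rewrite (le_trans (h n))// mulrAC hn.
Qed.

(** Where [nrm (g z) <= M] and [1 <= Re (g z)], the values of [g] lie well
    inside the disk of centre and radius [M ^+ 2], so that the geometric
    series of ratio [1 - g / M ^+ 2] converges uniformly to [M ^+ 2 / g]. *)
Lemma hol_inv g : hol g -> (forall z, nrm z < 1 -> 1 <= complex.Re (g z)) ->
  hol (fun z => (g z)^-1).
Proof.
move=> hg g1; apply: hol_of_local_uniform => r e r1 e0.
have [M0 M00 gM0] := hol_bounded hg r1.
pose M := M0 + 1; have M1 : 1 <= M by rewrite lerDr ltW.
have gM z : nrm z <= r -> nrm (g z) <= M.
  by move=> /gM0 h; rewrite (le_trans h)// lerDl.
pose A := M ^+ 2; have A1 : 1 <= A by rewrite expr_ge1// (le_trans ler01).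
have A0 : 0 < A by rewrite (lt_le_trans ltr01).
pose k z : C := 1 - (A^-1)%:C * g z.
pose q := Num.sqrt (1 - A^-1).
have A11 : 0 <= 1 - A^-1 by rewrite subr_ge0 invf_le1.
have q01 : 0 <= q < 1.
  rewrite sqrtr_ge0/= -[ltRHS]sqrtr1 ltr_sqrt// ltrBlDr ltrDl.
  by rewrite invr_gt0.
have kq z : nrm z <= r -> nrm (k z) <= q.
  move=> zr; rewrite -(@ler_pXn2r _ 2)// ?nnegrE ?nrm_ge0 ?sqrtr_ge0//.
  rewrite sqr_sqrtr// nrm_sqr /k.
  have -> : complex.Re (1 - (A^-1)%:C * g z) = 1 - A^-1 * complex.Re (g z).
    by rewrite ReB ReZ.
  have -> : complex.Im (1 - (A^-1)%:C * g z) = - (A^-1 * complex.Im (g z)).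
    by rewrite ImD ImN ImZ/= add0r.
  rewrite [leLHS](_ : _ = 1 - 2 * A^-1 * complex.Re (g z) +
    A^-1 ^+ 2 * nrm (g z) ^+ 2); last first.
    rewrite [in RHS]nrm_sqr.
    by move: A^-1 (complex.Re _) (complex.Im _) => a x y; ring.
  have h1 : A^-1 ^+ 2 * nrm (g z) ^+ 2 <= A^-1.
    rewrite -[leRHS]mulr1 expr2 -mulrA ler_pM2l ?invr_gt0//.
    by rewrite ler_pdivrMl// mulr1 ler_pXn2r ?nnegrE ?nrm_ge0 ?gM// (le_trans ler01).
  have h2 : A^-1 <= A^-1 * complex.Re (g z).
    by rewrite ler_peMr ?invr_ge0 ?(ltW A0)// g1// (le_lt_trans zr).
  by lra.
have hk : hol k by apply: holB; [exact: hol_cst|exact: holZ].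
have [n hn] := @geometric_small 1 _ _ q01 e0.
exists (fun z => \sum_(0 <= i < n) (A^-1)%:C * k z ^+ i).
  by apply: hol_sum => i; apply: holZ; exact: holX.
move=> z zr.
have gz0 : g z != 0.
  apply/eqP => gz; have := g1 z (le_lt_trans zr r1).
  by rewrite gz/= ler10.
have Anz : (A%:C : C) != 0 by rewrite eq_complex/= eqxx andbT gt_eqF.
have q1 : 1 - q != 0 by case/andP: q01 => _ q1; rewrite subr_eq0 gt_eqF.
have : (g z)^-1 - \sum_(0 <= i < n) (A^-1)%:C * k z ^+ i = k z ^+ n / g z.
  rewrite -mulr_sumr big_mkord.
  have -> : (A^-1)%:C = (1 - k z) / g z by rewrite /k subKr mulfK.
  have geo : (1 - k z) * \sum_(i < n) k z ^+ i = 1 - k z ^+ n.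
    by rewrite -[1 - k z]opprB mulNr -subrX1 opprB.
  by rewrite mulrAC geo mulrBl mul1r subKr.
move=> ->; rewrite nrmM nrmX nrmV.
rewrite (le_trans _ (hn n (leqnn n)))// mul1r.
have gz1 : 1 <= nrm (g z).
  by rewrite (le_trans (g1 z (le_lt_trans zr r1)))// (le_trans (ler_norm _))// Re_le_nrm.
rewrite ler_pdivrMr ?(lt_le_trans ltr01)//.
rewrite (@le_trans _ _ (q ^+ n))//; first by rewrite lerXn2r ?nnegrE ?nrm_ge0 ?sqrtr_ge0 ?kq.
by rewrite ler_peMr// exprn_ge0// sqrtr_ge0.
Qed.

End HolomorphicOnDisk.

(** * Taylor expansions and harmonic majorants *)

Section TaylorExpansion.
Variable R : realType.
Local Notation C := (Cplx R).
Local Notation nrm := (@Normc.normc R).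
Implicit Types (f g h : C -> C) (z c : C) (r e : R) (p : {poly R[i]}).
Implicit Types (a u : nat -> C).

Lemma diskE z : disk z <-> nrm z < 1.
Proof. by rewrite /disk/= nrmE (ltcR _ 1). Qed.

Lemma series_terms_bounded u (l : C) : series u @ \oo --> l ->
  exists2 M, 0 <= M & forall n, nrm (u n) <= M.
Proof.
move=> ul; have [N hN] := (cvg_seqC _ _).1 ul _ ltr01.
exists (2 + \sum_(i < N) nrm (u i)).
  by rewrite addr_ge0// sumr_ge0// => i _; exact: nrm_ge0.
move=> n; have [nN|Nn] := ltnP n N.
  rewrite (bigD1 (Ordinal nN))//= addrCA lerDl addr_ge0// sumr_ge0// => i _.
  exact: nrm_ge0.
rewrite ler_wpDr//; first by rewrite sumr_ge0// => i _; exact: nrm_ge0.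
have -> : u n = series u n.+1 - series u n.
  by rewrite /series/= big_nat_recr//= addrAC subrr add0r.
by rewrite (le_trans (nrm_distD l _ _))// lerD ?hN ?(nrmBC l) ?hN// ltnW.
Qed.

(** Convergence at one point of larger modulus bounds the coefficients. *)
Lemma taylor_geometric f a r : taylor_expansion f a -> 0 <= r < 1 ->
  exists M, exists2 q, 0 <= q < 1 &
    forall n z, nrm z <= r -> nrm (a n * z ^+ n) <= M * q ^+ n.
Proof.
move=> fa /andP[r0 r1]; pose s := (r + 1) / 2.
have s0 : 0 < s by rewrite /s; lra.
have s1 : s < 1 by rewrite /s; lra.
have [|M M0 hM] := @series_terms_bounded (fun n => a n * s%:C ^+ n) (f s%:C).
- by apply: fa; apply/diskE; rewrite nrm_real_ge0// ltW.
- exists M, (r / s).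
    by rewrite divr_ge0// 1?ltW// ltr_pdivrMr// mul1r /s; lra.
  move=> n z zr; rewrite expr_div_n mulrA ler_pdivlMr ?exprn_gt0//.
  apply: (@le_trans _ _ (nrm (a n) * r ^+ n * s ^+ n)).
    rewrite nrmM nrmX ler_wpM2r ?exprn_ge0 ?(ltW s0)// ler_wpM2l ?nrm_ge0//.
    by rewrite lerXn2r ?nnegrE ?nrm_ge0.
  rewrite mulrAC ler_wpM2r ?exprn_ge0//.
  by have := hM n; rewrite nrmM nrmX nrm_real_ge0// ltW.
Qed.

Lemma taylor_csum f a z : taylor_expansion f a -> nrm z < 1 ->
  f z = csum (fun n => a n * z ^+ n).
Proof. by move=> fa z1; apply/esym/csum_eq/fa/diskE. Qed.

(** Replaces a function by polynomials, to which the exact identities over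
    roots of unity apply. *)
Lemma taylor_remainder f a r : taylor_expansion f a -> 0 <= r < 1 ->
  exists M, exists2 q, 0 <= q < 1 & forall n z, nrm z <= r ->
    nrm (f z - (\poly_(i < n) a i).[z]) <= M * q ^+ n.
Proof.
move=> fa r01; have [M [q q01 hM]] := taylor_geometric fa r01.
exists (M / (1 - q)), q => // n z zr.
have [_ /(_ n)] := geometric_domination q01 (fun n => hM n z zr).
rewrite -(taylor_csum fa); last by case/andP: r01 => _; exact: le_lt_trans.
by rewrite mulrAC horner_poly /series/= big_mkord.
Qed.

Lemma taylor_hol f a : taylor_expansion f a -> hol f.
Proof.
move=> fa r e r1 e0.
have r01 : 0 <= Num.max 0 r < 1 by rewrite le_max lexx/= gt_max ltr01.
have [M [q q01 hM]] := taylor_remainder fa r01.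
have [n hn] := @geometric_small _ M _ _ q01 e0.
exists (\poly_(i < n) a i) => z zr.
by rewrite (le_trans (hM n z _)) ?hn// le_max zr orbT.
Qed.

(** The coefficients of the approximating polynomials converge by Cauchy's
    estimates, and their limits are the Taylor coefficients. *)
Lemma hol_taylor f : hol f -> exists a, taylor_expansion f a.
Proof.
move=> hf; pose r n : R := 1 - 2^-1 ^+ n.+1; pose e n : R := 2^-1 ^+ n.
have e0 n : 0 < e n by rewrite exprn_gt0// invr_gt0.
have r1 n : r n < 1 by rewrite /r ltrBlDr ltrDl exprn_gt0// invr_gt0.
have half01 : 0 <= (2^-1 : R) <= 1 by rewrite invr_ge0 ler0n invf_le1// ler1n.
have e_le m n : (m <= n)%N -> e n <= e m by move=> mn; case/andP: half01 => *; rewrite /e ler_wiXn2l.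
have r_le m n : (m <= n)%N -> r m <= r n.
  by move=> mn; rewrite lerD2l lerN2; exact: (e_le m.+1 n.+1).
have [p hp] : exists p : nat -> {poly R[i]},
    forall n z, nrm z <= r n -> nrm (f z - (p n).[z]) <= e n.
  have /choice[p hp] : forall n, exists p : {poly R[i]},
    forall z, nrm z <= r n -> nrm (f z - p.[z]) <= e n.
    by move=> n; exact: hf.
  by exists p.
have dp m n k s : (m <= n)%N -> 0 <= s <= r m ->
    nrm ((p m)`_k - (p n)`_k) * s ^+ k <= 2 * e m.
  move=> mn /andP[s0 sr]; rewrite -coefB; apply: poly_cauchy_estimate => //.
    by rewrite mulr_ge0// ltW.
  move=> z zs; rewrite hornerD hornerN (le_trans (nrm_distD (f z) _ _))//.
  rewrite mulr2n mulrDl !mul1r lerD//.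
    by rewrite nrmBC hp// zs.
  by rewrite (le_trans (hp _ _ _) (e_le _ _ mn))// zs (le_trans sr)// r_le.
have pl k : exists l : C, forall m s, 0 <= s <= r m ->
    nrm ((p m)`_k - l) * s ^+ k <= 2 * e m.
  pose d n : C := (p n.+1)`_k - (p n)`_k.
  have half01' : 0 <= (2^-1 : R) < 1 by rewrite invr_ge0 ler0n invf_lt1// ltr1n.
  have dh n : nrm (d n) <= 2 / 2^-1 ^+ k * 2^-1 ^+ n.
    rewrite mulrAC ler_pdivlMr ?exprn_gt0 ?invr_gt0// nrmBC.
    apply: dp => //; rewrite invr_ge0 ler0n/= (le_trans _ (r_le 0%N _ _))//.
    by rewrite /r expr1; lra.
  have [/cvg_seqC dl _] := geometric_domination half01' dh.
  have dE n : series d n = (p n)`_k - (p 0%N)`_k.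
    by rewrite /series/= telescope_sumr.
  exists ((p 0%N)`_k + csum d) => m s /andP[s0 sr].
  apply/ler_addgt0Pr => x x0; have [N hN] := dl _ x0.
  pose n := maxn m N.
  have s1 : s ^+ k <= 1 by rewrite exprn_ile1// (le_trans sr)// ltW.
  apply: (@le_trans _ _ ((nrm ((p m)`_k - (p n)`_k) + x) * s ^+ k)).
    rewrite ler_wpM2r ?exprn_ge0// (le_trans (nrm_distD (p n)`_k _ _))//.
    by rewrite lerD2l opprD addrA -dE hN// leq_maxr.
  by rewrite mulrDl lerD ?dp ?leq_maxl ?s0// ler_piMr// ltW.
have /choice[a ha] := pl; exists a => z /diskE z1.
pose s := (nrm z + 1) / 2; have z0 := nrm_ge0 z.
have s0 : 0 < s by rewrite /s; lra.
have s1 : s < 1 by rewrite /s; lra.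
pose q := nrm z / s.
have q0 : 0 <= q by rewrite divr_ge0// ltW.
have q1 : q < 1 by rewrite /q ltr_pdivrMr// mul1r /s; lra.
have q1' : 0 < 1 - q by rewrite subr_gt0.
apply/cvg_seqC => x x0.
have half01' : 0 <= (2^-1 : R) < 1 by rewrite invr_ge0 ler0n invf_lt1// ltr1n.
have s1' : 0 < 1 - s by rewrite subr_gt0.
have [N1 hN1] := @geometric_small _ 1 _ _ half01' s1'.
have [N2 hN2] := @geometric_small _ (2 / (1 - q) + 1) _ _ half01' x0.
pose n := maxn N1 N2.
have srn : s <= r n.
  have := hN1 n.+1; rewrite mul1r => h; rewrite /r lerBrDr addrC -lerBrDr.
  by apply: h; rewrite (leq_trans (leq_maxl _ N2)).
have zrn : nrm z <= r n by rewrite (le_trans _ srn)// /s; lra.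
exists (size (p n)) => m pm.
rewrite (le_trans _ (hN2 n (leq_maxr _ _)))// mulrDl mul1r.
rewrite (le_trans (nrm_distD (p n).[z] _ _))// lerD//; last by rewrite nrmBC hp.
rewrite (poly_horner_lt _ pm) /series/= big_mkord -sumrB.
rewrite (le_trans (nrm_sum _ _ _))//.
apply: (@le_trans _ _ (\sum_(k < m) 2 * e n * q ^+ k)).
  apply: ler_sum => k _; rewrite -mulrBl nrmM nrmX /q expr_div_n mulrA.
  rewrite ler_pdivlMr ?exprn_gt0// mulrAC ler_wpM2r ?exprn_ge0// nrmBC.
  by apply: ha; rewrite srn ltW.
rewrite -mulr_sumr mulrAC ler_pM2r// ler_pM2l//.
rewrite -(ler_pM2r q1') mulVf ?gt_eqF// mulrC -opprB mulNr -subrX1 opprB.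
by rewrite gerBl exprn_ge0.
Qed.

(** Cauchy's estimate for the difference of two partial sums, which tends to
    0 uniformly on the circle of radius 1/2. *)
Lemma taylor_unique f a b :
  taylor_expansion f a -> taylor_expansion f b -> a = b.
Proof.
move=> fa fb; apply/funext => k; apply/eqP; rewrite -subr_eq0 -nrm_eq0.
have h01 : 0 <= (2^-1 : R) < 1 by rewrite invr_ge0 ler0n invf_lt1// ltr1n.
have [M [q q01 hM]] := taylor_remainder fa h01.
have [M' [q' q01' hM']] := taylor_remainder fb h01.
apply/eqP/le_anti; rewrite nrm_ge0 andbT; apply/ler_addgt0Pr => e e0.
rewrite add0r -(@ler_pM2r _ (2^-1 ^+ k)) ?exprn_gt0 ?invr_gt0//.
have d0 : 0 < e * 2^-1 ^+ k / 2 by rewrite divr_gt0// mulr_gt0// exprn_gt0 ?invr_gt0.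
have [N hN] := @geometric_small _ M _ _ q01 d0.
have [N' hN'] := @geometric_small _ M' _ _ q01' d0.
pose n := maxn (maxn N N') k.+1.
pose p : {poly R[i]} := \poly_(i < n) a i - \poly_(i < n) b i.
have -> : a k - b k = p`_k.
  by rewrite coefB !coef_poly leq_maxr.
apply: poly_cauchy_estimate; rewrite ?invr_ge0 ?ler0n//.
  by rewrite mulr_ge0 ?exprn_ge0 ?invr_ge0// ltW.
move=> z z12; rewrite hornerD hornerN (le_trans (nrm_distD (f z) _ _))//.
rewrite [leRHS]splitr lerD//.
  by rewrite nrmBC (le_trans (hM _ _ _)) ?z12// hN// !leq_max leqnn.
by rewrite (le_trans (hM' _ _ _)) ?z12// hN'// !leq_max leqnn orbT.
Qed.

Lemma taylor_expansion_at0 f a : taylor_expansion f a -> f 0 = a 0%N.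
Proof.
move=> fa; apply: (@cvgC_unique _ (series (fun n => a n * 0 ^+ n))).
  by apply: fa; apply/diskE; rewrite nrm0.
apply/cvg_seqC => e e0; exists 1%N => -[//|n] _.
rewrite /series/= big_nat_recl//= expr0 mulr1 big1 ?addr0 ?subrr ?nrm0 ?ltW//.
by move=> i _; rewrite expr0n mulr0.
Qed.

(** The harmonic majorant [Re s] bounds the mean of [|h|^2] over each circle
    by [Re (s 0)].  The means are taken over roots of unity of high order,
    where Parseval's identity is exact for the partial sums. *)
Lemma harmonic_majorant h s a n : taylor_expansion h a -> hol s ->
    (forall z, nrm z < 1 -> nrm (h z) ^+ 2 <= complex.Re (s z)) ->
  \sum_(k < n) nrm (a k) ^+ 2 <= complex.Re (s 0).
Proof.
move=> ha /hol_taylor[b sb] hs.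
have circle r : 0 <= r < 1 ->
    \sum_(k < n) (nrm (a k) * r ^+ k) ^+ 2 <= complex.Re (s 0).
  move=> r01; have /andP[r0 r1] := r01; apply/ler_addgt0Pr => e e0.
  have [B B0 hB] := hol_bounded (taylor_hol ha) r1.
  have [M [q q01 hM]] := taylor_remainder ha r01.
  have [M' [q' q01' hM']] := taylor_remainder sb r01.
  pose d := Num.min 1 (e / 2 / (2 * B + 1)).
  have d0 : 0 < d by rewrite lt_min ltr01/= !divr_gt0// addr_gt0// mulr_gt0.
  have e20 : 0 < e / 2 by rewrite divr_gt0.
  have [N hN] := @geometric_small _ M _ _ q01 d0.
  have [N' hN'] := @geometric_small _ M' _ _ q01' e20.
  pose m := (maxn (maxn N N') n).+1.
  have [w pw] := @primitive_root_exists R m isT.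
  have m0 : 0 < m%:R :> R by rewrite ltr0n.
  have nm : (n <= m)%N by rewrite leqW// leq_maxr.
  have Nm : (N <= m)%N by rewrite leqW// !leq_max leqnn.
  have N'm : (N' <= m)%N by rewrite leqW// !leq_max leqnn orbT.
  pose p : {poly R[i]} := \poly_(i < m) a i.
  pose t : {poly R[i]} := \poly_(i < m) b i.
  have zr (j : 'I_m) : nrm (r%:C * w ^+ j) = r.
    by rewrite nrmM nrm_real_ge0// nrmX (nrm_primitive_root pw) expr1n mulr1.
  have pointwise (j : 'I_m) : nrm p.[r%:C * w ^+ j] ^+ 2 <=
      complex.Re t.[r%:C * w ^+ j] + e.
    set z := r%:C * w ^+ j.
    have h1 : nrm (h z) ^+ 2 <= complex.Re (s z) by rewrite hs// zr.
    have h2 : nrm (h z) <= B by rewrite hB// zr.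
    have h3 : nrm (h z - p.[z]) <= d by rewrite (le_trans (hM _ _ _)) ?hN ?zr.
    have h4 : nrm (s z - t.[z]) <= e / 2.
      by rewrite (le_trans (hM' _ _ _)) ?hN' ?zr.
    have h5 : complex.Re (s z) <= complex.Re t.[z] + e / 2.
      rewrite -lerBlDl -ReB (le_trans _ h4)// (le_trans (ler_norm _))//.
      exact: Re_le_nrm.
    have h6 : nrm p.[z] <= nrm (h z) + d.
      by rewrite -lerBlDl (le_trans (nrm_sub_ge _ _))// nrmBC.
    have d1 : d <= 1 by rewrite ge_min lexx.
    have d2 : d * (2 * B + 1) <= e / 2.
      rewrite -ler_pdivlMr ?addr_gt0 ?mulr_gt0//.
      by rewrite ge_min lexx orbT.
    apply: (@le_trans _ _ ((nrm (h z) + d) ^+ 2)).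
      by rewrite lerXn2r ?nnegrE ?addr_ge0 ?nrm_ge0// ltW.
    have := nrm_ge0 (h z); have := ltW d0; nra.
  rewrite -(ler_pM2l m0).
  apply: (@le_trans _ _ (m%:R * \sum_(k < m) (nrm p`_k * r ^+ k) ^+ 2)).
    rewrite ler_pM2l//.
    rewrite (big_ord_widen _ (fun k => (nrm (a k) * r ^+ k) ^+ 2) nm).
    rewrite [leRHS](bigID (fun k : 'I_m => (k < n)%N))/=.
    rewrite -[leLHS]addr0 lerD ?sumr_ge0// => [|k _]; last exact: sqr_ge0.
    by rewrite ler_sum// => k kn; rewrite coef_poly ltn_ord.
  rewrite -(poly_parseval _ pw) ?size_poly//.
  apply: (le_trans (ler_sum _ (fun j _ => pointwise j))).
  rewrite big_split/= -Re_sum (poly_mean _ pw) ?size_poly//.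
  rewrite sumr_const card_ord -[e *+ m]mulr_natl.
  have -> : complex.Re (m%:R * t`_0) = m%:R * complex.Re t`_0.
    by have := ReZ m%:R t`_0; rewrite rmorph_nat.
  by rewrite coef_poly/= -(taylor_expansion_at0 sb) mulrDr.
set A := \sum_(k < n) _.
have A0 : 0 <= A by apply: sumr_ge0 => k _; exact: sqr_ge0.
(* It remains to let the radius [1 - x] tend to 1; Bernoulli's inequality
   bounds the loss in each of the [n] terms. *)
have bernoulli (x : R) m : 0 <= x <= 1 -> 1 - m%:R * x <= (1 - x) ^+ m.
  move=> x01; elim: m => [|m ih]; first by rewrite mul0r subr0.
  rewrite exprS -natr1.
  have : (1 - x) * (1 - m%:R * x) <= (1 - x) * (1 - x) ^+ m.
    by rewrite ler_wpM2l// subr_ge0; case/andP: x01.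
  by apply: le_trans; have := ler0n R m; nra.
apply/ler_addgt0Pr => e e0.
pose x := Num.min 1 (e / ((2 * n)%:R * A + 1)).
have x0 : 0 < x by rewrite lt_min ltr01 divr_gt0// ltr_wpDl// mulr_ge0.
have x1 : x <= 1 by rewrite ge_min lexx.
have xe : x * ((2 * n)%:R * A + 1) <= e.
  by rewrite -ler_pdivlMr ?ltr_wpDl ?mulr_ge0// ge_min lexx orbT.
have r01 : 0 <= 1 - x < 1 by rewrite subr_ge0 x1 ltrBlDr ltrDl.
have hA : A * (1 - x) ^+ (2 * n) <= complex.Re (s 0).
  apply: le_trans (circle _ r01); rewrite /A mulr_suml ler_sum// => k _.
  have /andP[r0 r1] := r01.
  rewrite exprMn -exprM ler_wpM2l ?sqr_ge0// ler_wiXn2l ?(ltW r1)//.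
  by rewrite mulnC leq_mul// ltnW.
have hb : 1 - (2 * n)%:R * x <= (1 - x) ^+ (2 * n).
  by apply: bernoulli; rewrite ltW.
have : A * (1 - (2 * n)%:R * x) <= A * (1 - x) ^+ (2 * n) by rewrite ler_wpM2l.
by nra.
Qed.


End TaylorExpansion.

(** * Difference quotients and derivatives *)

Section Differentiability.
Variable R : realType.
Local Notation C := (Cplx R).
Local Notation nrm := (@Normc.normc R).
Implicit Types (f g h : C -> C) (z c : C) (r e : R).

(** With [a] the Taylor coefficients of [f], the quotient is the sum of the
    [a n * (z ^+ n.-1 + ... + c ^+ n.-1)]; it is dominated by a geometric
    series because [c] is bounded away from the circle of radius [s]. *)
Lemma hol_quotient f c : hol f -> nrm c < 1 ->
  exists2 q, hol q & forall z, nrm z < 1 -> f z - f c = (z - c) * q z.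
Proof.
move=> /hol_taylor[a fa] c1; have c0 := nrm_ge0 c.
pose S n z : C := \sum_(i < n) z ^+ (n.-1 - i) * c ^+ i.
have dom r : 0 <= r < 1 -> exists M, exists2 q, 0 <= q < 1 &
    forall n z, nrm z <= r -> nrm (a n * S n z) <= M * q ^+ n.
  move=> /andP[r0 r1]; pose s := (Num.max r (nrm c) + 1) / 2.
  have [rm cm] : r <= Num.max r (nrm c) /\ nrm c <= Num.max r (nrm c).
    by rewrite !le_max !lexx orbT.
  have m1 : Num.max r (nrm c) < 1 by rewrite gt_max r1.
  have s0 : 0 < s by rewrite /s; lra.
  have s1 : s < 1 by rewrite /s; lra.
  have cs : 0 < s - nrm c by rewrite /s; lra.
  have [|M [q q01 hM]] := @taylor_geometric _ _ _ s fa; first by rewrite ltW.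
  exists (M / (s - nrm c)), q => // n z zr; rewrite mulrAC ler_pdivlMr//.
  have zs : nrm z <= s by rewrite /s; lra.
  rewrite (le_trans _ (hM n s%:C _)) ?nrm_real_ge0 ?(ltW s0)//.
  rewrite !nrmM -mulrA ler_wpM2l ?nrm_ge0// nrmX nrm_real_ge0 ?(ltW s0)//.
  apply: (@le_trans _ _ ((\sum_(i < n) s ^+ (n.-1 - i) * nrm c ^+ i) * (s - nrm c))).
    rewrite ler_pM2r// (le_trans (nrm_sum _ _ _))// ler_sum// => i _.
    rewrite nrmM !nrmX ler_wpM2r ?exprn_ge0// lerXn2r ?nnegrE ?nrm_ge0//.
    exact: ltW.
  by rewrite mulrC -subrXX gerBl exprn_ge0.
exists (fun z => csum (fun n => a n * S n z)).
  apply: (@hol_csum _ (fun n z => a n * S n z)) => // n; apply: holZ.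
  by apply: hol_sum => i; apply: holM; [apply: holX; exact: hol_id|exact: hol_cst].
move=> z z1; have [|M [q q01 hM]] := dom (nrm z); first by rewrite nrm_ge0.
have [hS _] := geometric_domination q01 (fun n => hM n z (lexx _)).
apply: (@cvgC_unique _ (series (fun n => a n * z ^+ n) - series (fun n => a n * c ^+ n))).
  by apply: cvgB; apply: fa; apply/diskE.
rewrite (_ : _ - _ = (z - c) *: series (fun n => a n * S n z)).
  exact: cvgZr.
apply/funext => n; rewrite /series/= !fctE/= -sumrB scaler_sumr.
apply: eq_bigr => i _; rewrite -mulrBr subrXX /S.
exact: mulrCA.
Qed.

Lemma hol_continuous f c : hol f -> nrm c < 1 -> f z @[z --> c] --> f c.
Proof.
move=> hf c1; have [q hq fq] := hol_quotient hf c1.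
pose r := (nrm c + 1) / 2; have c0 := nrm_ge0 c.
have r1 : r < 1 by rewrite /r; lra.
have [M M0 hM] := hol_bounded hq r1.
move=> A /nbhs_nrmP[e e0 hA]; apply/nbhs_nrmP.
exists (Num.min (r - nrm c) (e / M)).
  by rewrite lt_min divr_gt0// andbT /r; lra.
move=> z; rewrite lt_min => /andP[zr ze].
have zr' : nrm z <= r.
  by have := nrm_sub_ge z c; have := ltW zr; lra.
apply: hA; rewrite fq ?nrmM; last exact: le_lt_trans r1.
rewrite (@le_lt_trans _ _ (nrm (z - c) * M))//.
  by rewrite ler_wpM2l ?nrm_ge0 ?hM.
by rewrite -ltr_pdivlMr.
Qed.

Lemma hol_derivable f c : hol f -> nrm c < 1 -> derivable f c 1.
Proof.
move=> hf c1; have [q hq fq] := hol_quotient hf c1.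
apply/cvg_ex; exists (q c).
move=> A /(hol_continuous hq c1)/nbhs_nrmP[e e0 hA].
apply: (nbhs_nrmP (0 : C) _).2; exists (Num.min e (1 - nrm c)).
  by rewrite lt_min e0 subr_gt0.
move=> h; rewrite subr0 lt_min => /andP[he h1] h0.
have hc1 : nrm (h + c) < 1 by have := nrmD h c; lra.
rewrite /= scaler1 fq// addrK /GRing.scale/= mulKf//.
by apply: hA; rewrite addrK.
Qed.

End Differentiability.

(** * The Hardy space through Taylor coefficients *)

Section HardySpace.
Variable R : realType.
Local Notation C := (Cplx R).
Local Notation H2 := (H2 R).
Local Notation nrm := (@Normc.normc R).
Implicit Types (f g : H2) (h : C -> C) (z c : C) (a : nat -> C).

Lemma l2sum_le a (B : R) : (forall n, \sum_(k < n) nrm (a k) ^+ 2 <= B) ->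
  (l2sum a <= B%:E)%E.
Proof.
move=> aB; apply: lime_le.
  by apply: is_cvg_nneseries => n _ _; rewrite lee_fin sqr_ge0.
by apply: nearW => n; rewrite sumEFin lee_fin big_mkord.
Qed.

Lemma l2sum_ge a n : ((\sum_(k < n) nrm (a k) ^+ 2)%:E <= l2sum a)%E.
Proof.
rewrite -(big_mkord xpredT (fun k => nrm (a k) ^+ 2)) -sumEFin.
by apply: nneseries_lim_ge => k _; rewrite lee_fin sqr_ge0.
Qed.

Lemma hardy_funP f : exists2 a, taylor_expansion f a & (l2sum a < +oo)%E.
Proof.
by have := valP f; rewrite unfold_in => /asboolP[_ [a fa la]]; exists a.
Qed.

Lemma taylor_coefP f : taylor_expansion f (taylor_coef f).
Proof. by have [a fa _] := hardy_funP f; apply: xgetPex; exists a. Qed.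
Arguments taylor_coefP : clear implicits.

Lemma taylor_coef_eq f a : taylor_expansion f a -> taylor_coef f = a.
Proof. by move=> fa; exact: taylor_unique (taylor_coefP f) fa. Qed.

Lemma hardy_hol f : hol f.
Proof. exact: taylor_hol (taylor_coefP f). Qed.

Lemma hardy_ext f g : (forall z, nrm z < 1 -> f z = g z) -> f = g.
Proof.
move=> fg; apply: val_inj; apply/funext => z /=.
have [/fg//|z1] := boolP (nrm z < 1).
have z1' : ~ disk z by move=> /diskE; exact/negP.
have := valP f; rewrite unfold_in => /asboolP[/(_ z z1') + _].
have := valP g; rewrite unfold_in => /asboolP[/(_ z z1') + _].
by move=> /= -> ->.
Qed.

Lemma hnorm_ge0 f : 0 <= hnorm f.
Proof. exact: sqrtr_ge0. Qed.

Lemma hnorm_sqr f : ((hnorm f ^+ 2)%:E = l2sum (taylor_coef f))%E.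
Proof.
have l0 : (0 <= l2sum (taylor_coef f))%E.
  by apply: nneseries_ge0 => n _ _; rewrite lee_fin sqr_ge0.
have [a fa la] := hardy_funP f.
rewrite /hnorm sqr_sqrtr ?fine_ge0// fineK//.
by rewrite ge0_fin_numE// (taylor_coef_eq fa).
Qed.

Lemma hnorm_partial_sum f n :
  \sum_(k < n) nrm (taylor_coef f k) ^+ 2 <= hnorm f ^+ 2.
Proof. by rewrite -lee_fin hnorm_sqr l2sum_ge. Qed.

Lemma hnorm_le f (B : R) : 0 <= B ->
  (forall n, \sum_(k < n) nrm (taylor_coef f k) ^+ 2 <= B ^+ 2) -> hnorm f <= B.
Proof.
move=> B0 fB; rewrite -(@ler_pXn2r _ 2)// ?nnegrE ?hnorm_ge0//.
by rewrite -lee_fin hnorm_sqr l2sum_le.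
Qed.

Lemma hardy_of_taylor h a (B : R) : taylor_expansion h a ->
    (forall n, \sum_(k < n) nrm (a k) ^+ 2 <= B) ->
  exists f : H2, forall z, nrm z < 1 -> f z = h z.
Proof.
move=> ha aB; pose h0 z := if nrm z < 1 then h z else 0.
have h0P : h0 \in @hardy R.
  rewrite unfold_in; apply/asboolP; split=> [z zD|].
    by rewrite /h0; case: ifPn => // z1; case: zD; apply/diskE.
  exists a; last exact: le_lt_trans (l2sum_le aB) (ltry _).
  by move=> z zD; rewrite /h0; move/diskE: (zD) => ->; exact: ha.
by exists (HardyFun h0P) => z z1; rewrite /= /h0 z1.
Qed.

Lemma hardyD f g z : (f + g) z = f z + g z.
Proof. by []. Qed.

Lemma hardyZ c f z : (c *: f) z = c * f z.
Proof. by []. Qed.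

Lemma taylor_expansionD h h' a a' c :
  taylor_expansion h a -> taylor_expansion h' a' ->
  taylor_expansion (fun z => c * h z + h' z) (fun n => c * a n + a' n).
Proof.
move=> ha ha' z zD.
rewrite (_ : series _ = c *: series (fun n => a n * z ^+ n) +
                        series (fun n => a' n * z ^+ n)).
  by apply: cvgD; [apply: cvgZr; exact: ha | exact: ha'].
apply/funext => n; rewrite /series/= !fctE/= scaler_sumr -big_split/=.
by apply: eq_bigr => i _; rewrite mulrDl -mulrA.
Qed.

Lemma taylor_coef_linear c f g n :
  taylor_coef (c *: f + g) n = c * taylor_coef f n + taylor_coef g n.
Proof.
have := @taylor_expansionD _ _ _ _ c (taylor_coefP f) (taylor_coefP g).
by move=> /(taylor_coef_eq (f := c *: f + g)) ->.
Qed.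

(** The parallelogram bound stands in for the triangle inequality of [hnorm],
    since only finiteness of the norm of a difference matters. *)
Lemma nrmB_sqr (x y : C) : nrm (x - y) ^+ 2 <= 2 * nrm x ^+ 2 + 2 * nrm y ^+ 2.
Proof.
have : nrm (x - y) ^+ 2 <= (nrm x + nrm y) ^+ 2.
  by rewrite lerXn2r ?nnegrE ?addr_ge0 ?nrm_ge0// nrmB.
move/le_trans; apply; move: (nrm x) (nrm y) => s t.
by rewrite -subr_ge0 [leRHS](_ : _ = (s - t) ^+ 2) ?sqr_ge0//; ring.
Qed.

Lemma sum_nrmB_sqr (a b : nat -> C) n (A B : R) :
    \sum_(k < n) nrm (a k) ^+ 2 <= A -> \sum_(k < n) nrm (b k) ^+ 2 <= B ->
  \sum_(k < n) nrm (a k - b k) ^+ 2 <= 2 * A + 2 * B.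
Proof.
move=> aA bB.
rewrite (le_trans (ler_sum _ (fun (k : 'I_n) _ => nrmB_sqr (a k) (b k))))//.
by rewrite big_split/= -!mulr_sumr lerD// ler_pM2l.
Qed.

Lemma hnormB f g : hnorm (f - g) ^+ 2 <= 2 * hnorm f ^+ 2 + 2 * hnorm g ^+ 2.
Proof.
rewrite -lee_fin hnorm_sqr; apply: l2sum_le => n.
have -> : taylor_coef (f - g) = (fun k => taylor_coef f k - taylor_coef g k).
  apply/funext => k; have := taylor_coef_linear (-1) g f k.
  by rewrite scaleN1r (addrC (- g)) mulN1r (addrC (- taylor_coef g k)).
exact: sum_nrmB_sqr (hnorm_partial_sum f n) (hnorm_partial_sum g n).
Qed.

Lemma cauchy_schwarz n (x y : 'I_n -> R) :
  (\sum_(i < n) x i * y i) ^+ 2 <= (\sum_(i < n) x i ^+ 2) * \sum_(i < n) y i ^+ 2.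
Proof.
elim: n x y => [|n ih] x y; first by rewrite !big_ord0 mul0r expr0n.
rewrite !big_ord_recr/=.
have := ih (fun i => x (widen_ord (leqnSn n) i)) (fun i => y (widen_ord (leqnSn n) i)).
set S := \sum_i _ * _; set X := \sum_i _ ^+ 2; set Y := \sum_i _ ^+ 2 => SXY.
have X0 : 0 <= X by apply: sumr_ge0 => i _; exact: sqr_ge0.
have Y0 : 0 <= Y by apply: sumr_ge0 => i _; exact: sqr_ge0.
set u := x ord_max; set v := y ord_max.
have h : 2 * S * (u * v) <= X * v ^+ 2 + Y * u ^+ 2.
  rewrite (le_trans (ler_norm _))// -(@ler_pXn2r _ 2)// ?nnegrE//; last first.
    by rewrite addr_ge0// mulr_ge0// sqr_ge0.
  rewrite real_normK ?num_real//.
  apply: (@le_trans _ _ (4 * (X * Y) * (u * v) ^+ 2)).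
    rewrite [leLHS](_ : _ = 4 * S ^+ 2 * (u * v) ^+ 2); last by ring.
    by rewrite ler_wpM2r ?sqr_ge0// ler_pM2l.
  rewrite -subr_ge0 [leRHS](_ : _ = (X * v ^+ 2 - Y * u ^+ 2) ^+ 2) ?sqr_ge0//.
  by ring.
rewrite -subr_ge0 [leRHS](_ : _ = (X * Y - S ^+ 2) +
  (X * v ^+ 2 + Y * u ^+ 2 - 2 * S * (u * v))); last by ring.
by rewrite addr_ge0 ?subr_ge0.
Qed.

(** The bound given by the reproducing kernel, whose squared norm at [z] is
    [1 / (1 - |z|^2)]. *)
Lemma hardy_eval f z : nrm z < 1 ->
  nrm (f z) ^+ 2 * (1 - nrm z ^+ 2) <= hnorm f ^+ 2.
Proof.
move=> z1; have fz := taylor_coefP f _ ((diskE z).2 z1).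
have z21 : nrm z ^+ 2 < 1 by rewrite expr_lt1// nrm_ge0.
have z20 : 0 < 1 - nrm z ^+ 2 by rewrite subr_gt0.
have lim := cvgC_norm fz.
pose v n := nrm (series (fun k => taylor_coef f k * z ^+ k) n).
have lim2 : v n * v n * (1 - nrm z ^+ 2) @[n --> \oo] -->
    nrm (f z) * nrm (f z) * (1 - nrm z ^+ 2).
  by apply: cvgM; [exact: cvgM|exact: cvg_cst].
rewrite expr2 -(cvg_lim _ lim2)//; apply: limr_le.
  by apply/cvg_ex; eexists; exact: lim2.
apply: nearW => n; rewrite /v.
rewrite -expr2 -ler_pdivlMr// (@le_trans _ _ ((\sum_(k < n) nrm (taylor_coef f k) * nrm z ^+ k) ^+ 2))//.
  rewrite lerXn2r ?nnegrE ?nrm_ge0//.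
    by apply: sumr_ge0 => k _; rewrite mulr_ge0 ?exprn_ge0 ?nrm_ge0.
  rewrite /series/= big_mkord (le_trans (nrm_sum _ _ _))//.
  by apply: ler_sum => k _; rewrite nrmM nrmX.
rewrite (le_trans (cauchy_schwarz _ _))// ler_pM ?sumr_ge0// => [k _|k _||].
- exact: sqr_ge0.
- exact: sqr_ge0.
- exact: hnorm_partial_sum.
under eq_bigr do rewrite -exprM mulnC exprM.
rewrite -(ler_pM2r z20) mulVf ?gt_eqF// mulrC -opprB mulNr -subrX1 opprB.
by rewrite gerBl !exprn_ge0// nrm_ge0.
Qed.

End HardySpace.

Arguments taylor_coefP {R} f.

(** * Division by a Blaschke factor *)

Section Deflation.
Variable R : realType.
Local Notation C := (Cplx R).
Local Notation H2 := (H2 R).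
Local Notation nrm := (@Normc.normc R).
Implicit Types (f g : H2) (z c : C).

Lemma hardy_coef_ext f g : taylor_coef f = taylor_coef g -> f = g.
Proof.
move=> fg; apply: hardy_ext => z z1.
by rewrite (taylor_csum (taylor_coefP f) z1) fg -(taylor_csum (taylor_coefP g) z1).
Qed.

Lemma linear_pack (F : H2 -> H2) :
    (forall c f g, F (c *: f + g) = c *: F f + F g) ->
  exists G : {linear H2 -> H2}, forall f, G f = F f.
Proof.
move=> Flin; pose m := GRing.isLinear.Build R[i] H2 H2 *:%R F Flin.
by exists (HB.pack F m : {linear H2 -> H2}).
Qed.

Lemma nrm_taylor_coef_le f n : nrm (taylor_coef f n) <= hnorm f.
Proof.
rewrite -(@ler_pXn2r _ 2)// ?nnegrE ?nrm_ge0 ?hnorm_ge0//.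
rewrite (le_trans _ (hnorm_partial_sum f n.+1))// big_ord_recr/= lerDr.
by apply: sumr_ge0 => i _; exact: sqr_ge0.
Qed.

Lemma taylor_coef_cvg0 f (e : R) : 0 < e ->
  exists N, forall n, (N <= n)%N -> nrm (taylor_coef f n) <= e.
Proof.
move=> e0; pose v n := nrm (taylor_coef f n) ^+ 2.
have /cvg_series_cvg_0 : cvgn (series v).
  apply: nondecreasing_is_cvgn.
    apply/nondecreasing_seqP => n; rewrite /series/= big_nat_recr//= lerDl.
    exact: sqr_ge0.
  exists (hnorm f ^+ 2) => _ [n _ <-].
  by rewrite /series/= big_mkord hnorm_partial_sum.
have e20 : 0 < e ^+ 2 by rewrite exprn_gt0.
move=> /cvgrPdist_le/(_ _ e20)[N _ hN]; exists N => n /hN/=.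
rewrite sub0r normrN ger0_norm ?sqr_ge0// => h.
by rewrite -(@ler_pXn2r _ 2)// ?nnegrE ?nrm_ge0 ?(ltW e0).
Qed.

(** Division by the Blaschke factor [(z - r) / (1 - r z)].  With [a] the
    coefficients of [f] and [u k] the sum of the [a (j + k) * r ^+ j], one has
    [a k = u k - r * u k.+1], and the quotient has the coefficients
    [u k.+1 - r * u k]; the difference of the squared moduli telescopes,
    whence the bound on the norm. *)
Lemma blaschke_division (r : R) : 0 <= r < 1 ->
  exists T : {linear H2 -> H2}, (forall f, hnorm (T f) <= hnorm f) /\
    forall f z, nrm z < 1 ->
      (1 - r%:C * z) * f z - (z - r%:C) * T f z = (1 - r%:C ^+ 2) * f r%:C.
Proof.
move=> r01; have /andP[r0 r1] := r01.
have nr : nrm r%:C = r by rewrite nrm_real_ge0.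
pose s f k : nat -> C := fun j => taylor_coef f (j + k) * r%:C ^+ j.
pose u f k := csum (s f k).
have domB f k (B : R) : (forall j, (k <= j)%N -> nrm (taylor_coef f j) <= B) ->
    forall j, nrm (s f k j) <= B * r ^+ j.
  move=> h j; rewrite nrmM nrmX nr ler_wpM2r ?exprn_ge0// h//.
  exact: leq_addl.
have dom f k := domB f k (hnorm f) (fun j _ => nrm_taylor_coef_le f j).
have s_cvg f k : series (s f k) @ \oo --> u f k.
  by have [] := geometric_domination r01 (dom f k).
have u_le f k (B : R) : (forall j, (k <= j)%N -> nrm (taylor_coef f j) <= B) ->
    nrm (u f k) <= B / (1 - r).
  move=> /domB h; have [_ /(_ 0%N)] := geometric_domination r01 (h).
  by rewrite /series/= big_geq// subr0 expr0 mulr1.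
have u0 f : u f 0%N = f r%:C.
  rewrite (taylor_csum (taylor_coefP f)) ?nr//; congr csum.
  by apply/funext => j; rewrite /s addn0.
have u_rec f k : u f k = taylor_coef f k + r%:C * u f k.+1.
  apply: (@cvgC_unique _ (fun n => series (s f k) n.+1)).
    by have /cvg_seqC h := s_cvg f k; apply/cvg_seqC => e /h[N hN]; exists N => n Nn; rewrite hN// leqW.
  rewrite (_ : (fun n => _) = cst (taylor_coef f k) + r%:C *: series (s f k.+1)).
    by apply: cvgD; [exact: cvg_cst|exact: cvgZr].
  apply/funext => n; rewrite /series/= !fctE/= big_nat_recl//= scaler_sumr.
  rewrite {1}/s add0n expr0 mulr1; congr (_ + _); apply: eq_bigr => j _.
  by rewrite /s addSnnS exprS mulrCA.
have u_lin c f g k : u (c *: f + g) k = c * u f k + u g k.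
  apply: (cvgC_unique (s_cvg _ _)).
  rewrite (_ : series _ = c *: series (s f k) + series (s g k)).
    by apply: cvgD; [exact: cvgZr|].
  apply/funext => n; rewrite /series/= !fctE/= scaler_sumr -big_split/=.
  by apply: eq_bigr => j _; rewrite /s taylor_coef_linear mulrDl -mulrA.
pose t f k : C := u f k.+1 - r%:C * u f k.
have t_sum f n : \sum_(k < n) nrm (t f k) ^+ 2 =
    \sum_(k < n) nrm (taylor_coef f k) ^+ 2 +
    (1 - r ^+ 2) * (nrm (u f n) ^+ 2 - nrm (u f 0) ^+ 2).
  elim: n => [|n ih]; first by rewrite !big_ord0 subrr mulr0 addr0.
  rewrite !big_ord_recr/= ih.
  have -> : taylor_coef f n = u f n - r%:C * u f n.+1 by rewrite [u f n]u_rec addrK.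
  rewrite /t; move: (u f n) (u f n.+1) => [x y] [x' y'].
  by rewrite !nrm_sqr/=; ring.
have t_le f n : \sum_(k < n) nrm (t f k) ^+ 2 <= hnorm f ^+ 2.
  apply/ler_addgt0Pr => e e0.
  (* [u f m] tends to 0, because the coefficients of [f] do. *)
  pose d := Num.min 1 e * (1 - r).
  have d0 : 0 < d by rewrite mulr_gt0 ?lt_min ?ltr01 ?subr_gt0.
  have [N hN] := taylor_coef_cvg0 f d0.
  pose m := maxn n N.
  have um : nrm (u f m) <= Num.min 1 e.
    rewrite (le_trans (u_le f m d _))//; last by rewrite /d mulfK// subr_eq0 gt_eqF.
    by move=> j mj; apply: hN; rewrite (leq_trans (leq_maxr n N)).
  apply: (@le_trans _ _ (\sum_(k < m) nrm (t f k) ^+ 2)).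
    rewrite (big_ord_widen _ (fun k => nrm (t f k) ^+ 2) (leq_maxl n N)).
    rewrite [leRHS](bigID (fun k : 'I_m => (k < n)%N))/= lerDl.
    by apply: sumr_ge0 => k _; exact: sqr_ge0.
  rewrite t_sum lerD ?hnorm_partial_sum//.
  have [m1 me] : Num.min 1 e <= 1 /\ Num.min 1 e <= e by rewrite !ge_min !lexx orbT.
  have := nrm_ge0 (u f m); have := sqr_ge0 (nrm (u f 0)).
  have r20 : 0 <= 1 - r ^+ 2 <= 1 by rewrite subr_ge0 expr_le1 ?(ltW r1)//= gerBl sqr_ge0.
  have u2 : nrm (u f m) ^+ 2 <= e by have := nrm_ge0 (u f m); nra.
  move: r20 => /andP[]; nra.
have t_bound f k : nrm (t f k) <= hnorm f.
  rewrite -(@ler_pXn2r _ 2)// ?nnegrE ?nrm_ge0 ?hnorm_ge0//.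
  rewrite (le_trans _ (t_le f k.+1))// big_ord_recr/= lerDr.
  by apply: sumr_ge0 => i _; exact: sqr_ge0.
have /choice[T hT] f : exists g : H2, taylor_coef g = t f.
  pose h z := csum (fun k => t f k * z ^+ k).
  have ht : taylor_expansion h (t f).
    move=> z /diskE z1; have z01 : 0 <= nrm z < 1 by rewrite nrm_ge0.
    have [|//] := @geometric_domination _ (fun k => t f k * z ^+ k) (hnorm f) _ z01.
    by move=> k; rewrite nrmM nrmX ler_wpM2r ?exprn_ge0 ?nrm_ge0.
  have [g gh] := hardy_of_taylor ht (t_le f); exists g; apply: taylor_coef_eq.
  by move=> z zD; rewrite gh; [exact: ht|exact/diskE].
have Tlin c f g : T (c *: f + g) = c *: T f + T g.
  apply: hardy_coef_ext; apply/funext => k.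
  rewrite hT taylor_coef_linear !hT /t !u_lin.
  by clear -u; clearbody u; ring.
have [G GT] := linear_pack Tlin; exists G; split=> [f|f z z1]; rewrite GT.
  by apply: hnorm_le => [|n]; rewrite ?hnorm_ge0// hT t_le.
have zD := (diskE z).2 z1.
have finite n : (1 - r%:C * z) * series (fun k => taylor_coef f k * z ^+ k) n -
    (z - r%:C) * series (fun k => t f k * z ^+ k) n =
    (1 - r%:C ^+ 2) * (u f 0%N - z ^+ n * u f n).
  elim: n => [|n ih]; first by rewrite /series/= !big_geq// expr0 mul1r subrr !mulr0 subr0.
  have sS (v : nat -> C) : series v n.+1 = series v n + v n.
    by rewrite /series/= big_nat_recr.
  rewrite !sS; move: ih; set A := series _ n; set B := series _ n => ih.
  have -> : taylor_coef f n = u f n - r%:C * u f n.+1 by rewrite [u f n]u_rec addrK.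
  rewrite (_ : _ - _ = ((1 - r%:C * z) * A - (z - r%:C) * B) +
    (1 - r%:C ^+ 2) * (z ^+ n * u f n - z ^+ n.+1 * u f n.+1)).
    by rewrite ih -mulrDr addrA subrK.
  rewrite /t (exprS z); move: (u f n) (u f n.+1) (z ^+ n) => x y w.
  by clearbody A B; ring.
apply: (@cvgC_unique _ (fun n => (1 - r%:C * z) * series (fun k => taylor_coef f k * z ^+ k) n -
    (z - r%:C) * series (fun k => t f k * z ^+ k) n)).
  apply: cvgB; apply: (@cvgZr _ R[i]^o); first exact: taylor_coefP.
  by rewrite -hT; exact: taylor_coefP.
under eq_fun do rewrite finite.
rewrite -u0; apply/cvg_seqC => e e0.
have z01 : 0 <= nrm z < 1 by rewrite nrm_ge0.
have [N hN] := @geometric_small _ (nrm (1 - r%:C ^+ 2) * (hnorm f / (1 - r))) _ _ z01 e0.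
exists N => n /hN; apply: le_trans.
rewrite -mulrBr addrAC subrr add0r nrmM nrmN nrmM nrmX -mulrA ler_wpM2l ?nrm_ge0//.
rewrite mulrC ler_wpM2r ?exprn_ge0 ?nrm_ge0//.
by apply: u_le => j _; exact: nrm_taylor_coef_le.
Qed.

End Deflation.

(** * Weighted composition operators and approximation numbers *)

Section FiniteRankApproximation.
Variable R : realType.
Local Notation C := (Cplx R).
Local Notation H2 := (H2 R).
Local Notation nrm := (@Normc.normc R).
Implicit Types (f g : H2) (z c : C) (h s : C -> C).

(** The normalisation [1 <= Re h] of [hol_inv] is a matter of scaling. *)
Lemma hol_inv_pos h (d : R) : 0 < d -> hol h ->
  (forall z, nrm z < 1 -> d <= complex.Re (h z)) -> hol (fun z => (h z)^-1).
Proof.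
move=> d0 hh hd; have d0' : (d%:C : C) != 0 by rewrite eq_complex/= eqxx andbT gt_eqF.
apply: hol_eq (holZ (d^-1)%:C (@hol_inv _ (fun z => (d^-1)%:C * h z) _ _)).
- by move=> z z1; rewrite invfM mulVKf// fmorphV invr_eq0.
- exact: holZ.
- by move=> z z1; rewrite ReZ ler_pdivlMl// mulr1 hd.
Qed.

Lemma hol_comp h (psi : C -> C) : hol h -> hol psi ->
    (forall r, r < 1 -> exists2 q, q < 1 &
      forall z, nrm z <= r -> nrm (psi z) <= q) ->
  hol (fun z => h (psi z)).
Proof.
move=> hh hpsi psi1; apply: hol_of_local_uniform => r e r1 e0.
have [q q1 hq] := psi1 _ r1; have [p hp] := hh _ _ q1 e0.
exists (fun z => p.[psi z]); last by move=> z zr; exact/hp/hq.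
apply: (@hol_eq _ (fun z => \sum_(i < size p) p`_i * psi z ^+ i)).
  by move=> z _; rewrite horner_coef.
by apply: hol_sum => i; apply: holZ; exact: holX.
Qed.

(** Membership in the Hardy space, with a bound on the norm, from a pointwise
    estimate inside the disk: no boundary values are involved. *)
Lemma hardy_of_majorant h s : hol h -> hol s ->
    (forall z, nrm z < 1 -> nrm (h z) ^+ 2 <= complex.Re (s z)) ->
  exists2 f : H2, (forall z, nrm z < 1 -> f z = h z) &
    hnorm f ^+ 2 <= complex.Re (s 0).
Proof.
move=> /hol_taylor[a ha] hs hsz.
have bound n := harmonic_majorant n ha hs hsz.
have [f fh] := hardy_of_taylor ha bound; exists f => //.
rewrite -lee_fin hnorm_sqr (_ : taylor_coef f = a); first exact: l2sum_le.
by apply: taylor_coef_eq => z zD; rewrite fh; [exact: ha|exact/diskE].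
Qed.

Definition blaschke (r : R) (w : C) : C := (w - r%:C) / (1 - r%:C * w).

Definition blaschke_product (rs : seq R) (w : C) : C :=
  \prod_(r <- rs) blaschke r w.

Lemma Re_blaschke_denom (r : R) (w : C) : 0 <= r -> nrm w < 1 ->
  1 - r <= complex.Re (1 - r%:C * w).
Proof.
move=> r0 w1; rewrite ReB ReZ lerD2l lerN2 ler_piMr//.
by rewrite (le_trans (ler_norm _))// (le_trans (Re_le_nrm _))// ltW.
Qed.

Lemma blaschke_denom_neq0 (r : R) (w : C) : 0 <= r < 1 -> nrm w < 1 ->
  1 - r%:C * w != 0.
Proof.
move=> /andP[r0 r1] w1; apply/eqP => h.
by have := Re_blaschke_denom r0 w1; rewrite h/=; lra.
Qed.

Lemma nrm_blaschke_le1 (r : R) (w : C) : 0 <= r < 1 -> nrm w < 1 ->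
  nrm (blaschke r w) <= 1.
Proof.
move=> r01 w1; have dn := blaschke_denom_neq0 r01 w1; have /andP[r0 r1] := r01.
rewrite nrmM nrmV ler_pdivrMr ?nrm_gt0// mul1r.
rewrite -(@ler_pXn2r _ 2)// ?nnegrE ?nrm_ge0//.
have w2 : nrm w ^+ 2 <= 1 by rewrite expr_le1 ?nrm_ge0 ?(ltW w1).
have r2 : r ^+ 2 <= 1 by rewrite expr_le1 ?(ltW r1).
move: w2; case: w {w1 dn} => x y; rewrite !nrm_sqr/= => w2.
rewrite -subr_ge0 [leRHS](_ : _ = (1 - r ^+ 2) * (1 - (x ^+ 2 + y ^+ 2))).
  by rewrite mulr_ge0// subr_ge0.
by ring.
Qed.

Lemma opnorm_le (T : H2 -> H2) (B : R) :
  (forall f, hnorm f <= 1 -> hnorm (T f) <= B) -> (opnorm T <= B%:E)%E.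
Proof.
by move=> TB; apply: ge_ereal_sup => _ [f f1 <-]; rewrite lee_fin TB.
Qed.

Variable psi : C -> C.
Hypothesis psi_hol : hol psi.
Hypothesis psi_inside : forall r, r < 1 -> exists2 q, q < 1 &
  forall z, nrm z <= r -> nrm (psi z) <= q.

Lemma psi_lt1 z : nrm z < 1 -> nrm (psi z) < 1.
Proof. by move=> /psi_inside[q q1 /(_ z (lexx _))] /le_lt_trans; apply. Qed.

(** The pointwise bound for functions of the Hardy space turns a harmonic
    majorant of [|beta|^2 / (1 - |psi|^2)] into a Hilbert-Schmidt type bound
    for [f |-> beta (f \o psi)]. *)
Lemma weighted_composition (beta s : C -> C) : hol beta -> hol s ->
    (forall z, nrm z < 1 ->
      nrm (beta z) ^+ 2 <= complex.Re (s z) * (1 - nrm (psi z) ^+ 2)) ->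
  exists2 W : {linear H2 -> H2},
    (forall f z, nrm z < 1 -> W f z = beta z * f (psi z)) &
    (forall f, hnorm (W f) ^+ 2 <= hnorm f ^+ 2 * complex.Re (s 0)).
Proof.
move=> hbeta hs bs.
have /choice[W hW] f : exists g : H2,
    (forall z, nrm z < 1 -> g z = beta z * f (psi z)) /\
    hnorm g ^+ 2 <= hnorm f ^+ 2 * complex.Re (s 0).
  have hh : hol (fun z => beta z * f (psi z)).
    by apply: holM => //; apply: hol_comp => //; exact: hardy_hol.
  have hs' := holZ (hnorm f ^+ 2)%:C hs.
  have [|g gh gn] := hardy_of_majorant hh hs'.
    move=> z z1; have w1 := psi_lt1 z1.
    have d0 : 0 < 1 - nrm (psi z) ^+ 2 by rewrite subr_gt0 expr_lt1 ?nrm_ge0.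
    rewrite ReZ nrmM exprMn -(ler_pM2r d0) -mulrA -[leRHS]mulrA [leRHS]mulrC.
    apply: ler_pM; [exact: sqr_ge0| |exact: bs|exact: hardy_eval].
    by rewrite mulr_ge0 ?sqr_ge0 ?(ltW d0).
  by exists g; split=> //; rewrite ReZ in gn.
have Wlin c f g : W (c *: f + g) = c *: W f + W g.
  apply: hardy_ext => z z1; rewrite hardyD hardyZ.
  rewrite (proj1 (hW (c *: f + g)) z z1) (proj1 (hW f) z z1) (proj1 (hW g) z z1).
  by rewrite hardyD hardyZ mulrDr mulrCA.
have [G GW] := linear_pack Wlin; exists G => f; last by rewrite GW; have [] := hW f.
by move=> z z1; rewrite GW; have [->] := hW f.
Qed.

Lemma hol_blaschke (r : R) : 0 <= r < 1 ->
  hol (fun z => blaschke r (psi z)).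
Proof.
move=> /andP[r0 r1]; apply: holM; first by apply: holB => //; exact: hol_cst.
apply: (@hol_inv_pos _ (1 - r)); first by rewrite subr_gt0.
  by apply: holB; [exact: hol_cst|exact: holZ].
by move=> z /psi_lt1; exact: Re_blaschke_denom.
Qed.

Lemma hol_blaschke_product (rs : seq R) : {in rs, forall r, 0 <= r < 1} ->
  hol (fun z => blaschke_product rs (psi z)).
Proof.
rewrite /blaschke_product; elim: rs => [_|r rs ih rs1].
  by apply: hol_eq (hol_cst 1) => z _; rewrite big_nil.
have h1 : hol (fun z => blaschke r (psi z)).
  by apply: hol_blaschke; apply: rs1; rewrite mem_head.
have h2 := ih (fun x xrs => rs1 x (mem_behead (s := r :: rs) xrs)).
by apply: hol_eq (holM h1 h2) => z _; rewrite big_cons.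
Qed.

Lemma nrm_blaschke_product_le1 (rs : seq R) (w : C) :
    {in rs, forall r, 0 <= r < 1} -> nrm w < 1 ->
  nrm (blaschke_product rs w) <= 1.
Proof.
move=> rs1 w1; rewrite /blaschke_product big_seq.
apply: (big_ind (fun x => nrm x <= 1)) => [|x y x1 y1|r /rs1 r01].
- by rewrite nrm1.
- by rewrite nrmM mulr_ile1 ?nrm_ge0.
- exact: nrm_blaschke_le1.
Qed.

Definition rank_le k (S : H2 -> H2) := exists e : 'I_k -> H2,
  forall f, exists c : 'I_k -> R[i], S f = \sum_(i < k) c i *: e i.

Lemma rank_leD1 k (S S' : H2 -> H2) (e : H2) :
    rank_le k S -> (forall f, exists c : R[i], S' f = S f + c *: e) ->
  rank_le k.+1 S'.
Proof.
move=> [e0 Se] SS'; exists (fun i => oapp e0 e (unlift ord_max i)) => f.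
have [c0 Sf] := Se f; have [c S'f] := SS' f.
exists (fun i => oapp c0 c (unlift ord_max i)).
rewrite big_ord_recr/= unlift_none/= S'f Sf; congr (_ + _).
apply: eq_bigr => i _.
have -> : widen_ord (leqnSn k) i = lift ord_max i.
  by apply: val_inj; rewrite /= /bump leqNgt ltn_ord.
by rewrite liftK.
Qed.

Variables (Cpsi : {linear H2 -> H2}) (s0 : C -> C).
Hypothesis Cpsi_comp : is_composition_operator psi Cpsi.
Hypothesis s0_hol : hol s0.
Hypothesis s0_major : forall z, nrm z < 1 ->
  1 <= complex.Re (s0 z) * (1 - nrm (psi z) ^+ 2).

(** Successive divisions by Blaschke factors write [f] as an element of a fixed
    space of dimension [size rs], plus the Blaschke product times a function
    of no larger norm; composition with [psi] preserves this splitting. *)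
Lemma composition_deflation (rs : seq R) : {in rs, forall r, 0 <= r < 1} ->
  exists T W : {linear H2 -> H2}, [/\ (forall f, hnorm (T f) <= hnorm f),
    (forall f z, nrm z < 1 ->
       W f z = blaschke_product rs (psi z) * f (psi z)) &
    rank_le (size rs) (fun f => Cpsi f - W (T f))].
Proof.
elim: rs => [_|r rs ih rs1].
  exists idfun, Cpsi; split=> //.
    move=> f z z1; rewrite /blaschke_product big_nil mul1r.
    by rewrite Cpsi_comp//; exact/diskE.
  by exists (fun=> 0) => f; exists (fun=> 0); rewrite subrr big_ord0.
have r01 : 0 <= r < 1 by apply: rs1; rewrite mem_head.
have rs1' : {in rs, forall r, 0 <= r < 1}.
  by move=> x xrs; apply: rs1; rewrite inE xrs orbT.
have [T [W [Tle WE rk]]] := ih rs1'.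
have [D [Dle DE]] := blaschke_division r01.
have hB := hol_blaschke_product rs1.
have [|W' W'E _] := weighted_composition hB s0_hol.
  move=> z z1; rewrite (le_trans _ (s0_major z1))//.
  by rewrite expr_le1 ?nrm_ge0// nrm_blaschke_product_le1// psi_lt1.
have /andP[r0 r1] := r01.
have hk : hol (fun z => blaschke_product rs (psi z) / (1 - r%:C * psi z)).
  apply: holM; first exact: hol_blaschke_product.
  apply: (@hol_inv_pos _ (1 - r)); first by rewrite subr_gt0.
    by apply: holB; [exact: hol_cst|exact: holZ].
  by move=> z /psi_lt1; exact: Re_blaschke_denom.
have [|e eE _] := @hardy_of_majorant _ (fun=> ((1 - r)^-1 ^+ 2)%:C) hk (@hol_cst _ _).
  move=> z z1; have w1 := psi_lt1 z1; have dn := blaschke_denom_neq0 r01 w1.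
  have r1' : 0 < 1 - r by rewrite subr_gt0.
  rewrite nrmM nrmV exprMn /= -[leRHS]mul1r ler_pM ?sqr_ge0//.
    by rewrite expr_le1 ?nrm_ge0// nrm_blaschke_product_le1.
  rewrite lerXn2r ?nnegrE ?invr_ge0 ?nrm_ge0 ?(ltW r1')// lef_pV2 ?posrE ?nrm_gt0//.
  rewrite (le_trans (Re_blaschke_denom r0 w1))// (le_trans (ler_norm _))//.
  exact: Re_le_nrm.
exists (D \o T), W'; split.
- by move=> f; exact: le_trans (Dle _) (Tle _).
- exact: W'E.
- apply: (rank_leD1 (e := e) rk) => f.
  exists ((1 - r%:C ^+ 2) * T f r%:C).
  rewrite -addrA; congr (_ + _); apply: hardy_ext => z z1.
  have w1 := psi_lt1 z1; have dn := blaschke_denom_neq0 r01 w1.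
  have hardyN (g : H2) : (- g) z = - g z by [].
  rewrite hardyD hardyZ -(DE (T f) (psi z) w1) (eE z z1) !hardyN.
  rewrite (W'E (D (T f)) z z1) (WE (T f) z z1) /blaschke_product big_cons /blaschke.
  move: (D (T f) (psi z)) (T f (psi z)) (\prod_(i <- rs) _) => x y b.
  move: (psi z) dn => w; move: r%:C => q dn.
  by field.
Qed.

(** The operator [W \o T] of the splitting is the error of an approximation of
    rank at most [size rs], and its norm is controlled by any harmonic
    majorant of [|B (psi)|^2 / (1 - |psi|^2)], [B] the Blaschke product. *)
Lemma approximation_number_le (rs : seq R) (s : C -> C) n :
    {in rs, forall r, 0 <= r < 1} -> (size rs < n)%N -> hol s ->
    (forall z, nrm z < 1 -> nrm (blaschke_product rs (psi z)) ^+ 2 <=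
       complex.Re (s z) * (1 - nrm (psi z) ^+ 2)) ->
  (approximation_number n Cpsi <= (Num.sqrt (complex.Re (s 0)))%:E)%E.
Proof.
move=> rs1 rsn hs sz.
have [T [W [Tle WE rk]]] := composition_deflation rs1.
have hB := hol_blaschke_product rs1.
have [W' W'E W'le] := weighted_composition hB hs sz.
have WW' f : W f = W' f by apply: hardy_ext => z z1; rewrite WE// W'E.
have [|C' C'E C'le] := weighted_composition (@hol_cst _ 1) s0_hol.
  by move=> z z1; rewrite nrm1 expr1n s0_major.
have CC' f : Cpsi f = C' f.
  by apply: hardy_ext => z z1; rewrite C'E// mul1r Cpsi_comp//; exact/diskE.
have Slin c f g : Cpsi (c *: f + g) - W (T (c *: f + g)) =
    c *: (Cpsi f - W (T f)) + (Cpsi g - W (T g)).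
  by rewrite [Cpsi _]linearP [T _]linearP [W _]linearP scalerBr opprD addrACA.
have [S SE] := linear_pack Slin.
have z01 : nrm (0 : C) < 1 by rewrite nrm0.
have d0 : 0 < 1 - nrm (psi 0) ^+ 2.
  by rewrite subr_gt0 expr_lt1 ?nrm_ge0 ?psi_lt1.
have Rs : 0 <= complex.Re (s 0).
  by have := le_trans (sqr_ge0 _) (sz 0 z01); rewrite pmulr_lge0.
have Rs0 : 0 <= complex.Re (s0 0).
  by have := le_trans ler01 (s0_major z01); rewrite pmulr_lge0.
have sqr_le1 f : hnorm f <= 1 -> hnorm f ^+ 2 <= 1.
  by move=> f1; apply: exprn_ile1; first exact: hnorm_ge0.
have Wle f : hnorm f <= 1 -> hnorm (W (T f)) ^+ 2 <= complex.Re (s 0).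
  move=> f1; rewrite WW'; apply: (le_trans (W'le (T f))).
  by apply: ler_piMl => //; apply: sqr_le1; exact: le_trans (Tle f) f1.
have Cle f : hnorm f <= 1 -> hnorm (Cpsi f) ^+ 2 <= complex.Re (s0 0).
  move=> f1; rewrite CC'; apply: (le_trans (C'le f)).
  by apply: ler_piMl => //; exact: sqr_le1.
have sqrt_le f (B : R) : hnorm f ^+ 2 <= B -> hnorm f <= Num.sqrt B.
  by move=> /ler_wsqrtr; rewrite sqrtr_sqr ger0_norm// hnorm_ge0.
apply: (@le_trans _ _ (opnorm (fun f => Cpsi f - S f))); last first.
  by apply: opnorm_le => f f1; rewrite SE subKr; exact/sqrt_le/Wle.
apply: ereal_inf_lbound; exists S => //; split; last first.
  exists (size rs); split=> //; have [e he] := rk; exists e => f.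
  by have [c hc] := he f; exists c; rewrite SE.
pose B := Num.sqrt (2 * complex.Re (s0 0) + 2 * complex.Re (s 0)).
apply: (@le_lt_trans _ _ B%:E); last exact: ltry.
apply: opnorm_le => f f1; apply: sqrt_le; rewrite SE.
apply: (le_trans (hnormB _ _)).
apply: lerD; apply: ler_wpM2l; [by []|exact: Cle|by []|exact: Wle].
Qed.

Lemma composition_bounded : bounded_operator Cpsi.
Proof.
have [|C' C'E C'le] := weighted_composition (@hol_cst _ 1) s0_hol.
  by move=> z z1; rewrite nrm1 expr1n s0_major.
have CC' f : Cpsi f = C' f.
  by apply: hardy_ext => z z1; rewrite C'E// mul1r Cpsi_comp//; exact/diskE.
pose B := Num.sqrt (complex.Re (s0 0)).
apply: (@le_lt_trans _ _ B%:E); last exact: ltry.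
apply: opnorm_le => f f1; rewrite CC'.
have := C'le f => /ler_wsqrtr; rewrite sqrtr_sqr ger0_norm ?hnorm_ge0//.
move/le_trans; apply; apply: ler_wsqrtr; apply: ler_piMl.
  have z01 : nrm (0 : C) < 1 by rewrite nrm0.
  have := le_trans ler01 (s0_major z01); rewrite pmulr_lge0//.
  by rewrite subr_gt0 expr_lt1 ?nrm_ge0 ?psi_lt1.
by apply: exprn_ile1; first exact: hnorm_ge0.
Qed.

End FiniteRankApproximation.

(** * Null subsets of the circle *)

Section NullSets.
Variable R : realType.
Local Notation C := (Cplx R).
Local Notation nrm := (@Normc.normc R).
Implicit Types (z c : C) (K : set C).

(** Lebesgue measure is the outer measure attached to the lengths of half-open
    intervals, so that a null set has covers of arbitrarily small length. *)
Lemma null_cover (A : set R) (e : R) :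
    (@lebesgue_measure R).-negligible A -> 0 < e ->
  exists I : nat -> R * R, [/\ (forall n, (I n).1 <= (I n).2),
    A `<=` \bigcup_n `](I n).1, (I n).2]%classic &
    forall N, \sum_(n < N) ((I n).2 - (I n).1) <= e].
Proof.
move=> [B [mB B0 AB]] e0.
have : (@lebesgue_measure R B < e%:E)%E by rewrite B0 lte_fin.
move=> /ereal_inf_lt[x [M [/= mM BM] Mx xe]].
have /choice[I hI] n : exists p : R * R, [/\ p.1 <= p.2,
    M n `<=` `]p.1, p.2]%classic & wlength idfun (M n) = (p.2 - p.1)%:E].
  have /ocitvP[->|[p p12 ->]] := mM n.
    by exists (0, 0); split=> //=; rewrite wlength0 subrr.
  by exists p; split=> //; [exact: ltW|rewrite wlength_itv_bnd// ltW].
exists I; split => [n|t At|N]; first by have [] := hI n.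
  have [n _ Mnt] := BM _ (AB _ At); exists n => //.
  by have [_ + _] := hI n; exact.
rewrite -lee_fin -(big_mkord xpredT (fun n => (I n).2 - (I n).1)) -sumEFin.
apply: le_trans (ltW xe); rewrite -Mx.
under eq_bigr => n _ do have [_ _ <-] := hI n.
apply: nneseries_lim_ge => n _ _; have [p12 _ ->] := hI n.
by rewrite lee_fin subr_ge0.
Qed.

Lemma derivative_le1_lipschitz (f df : R -> R) :
    (forall x, is_derive x (1 : R) f (df x)) -> (forall x, `|df x| <= 1) ->
  forall s t, `|f s - f t| <= `|s - t|.
Proof.
move=> fdf df1 s t; wlog st : s t / s <= t.
  have [st|/ltW ts] := leP s t; first exact.
  by move=> /(_ _ _ ts); rewrite distrC (distrC s).
have cf : {within `[s, t], continuous f}.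
  apply: continuous_subspaceT => x.
  by apply: differentiable_continuous; apply/derivable1_diffP; have [] := fdf x.
have [c _ h] := MVT_segment st (fun x _ => fdf x) cf.
rewrite distrC h normrM (distrC s) ler_piMl//.
Qed.

Lemma nrm_cis_sub (s t : R) : nrm (cis s - cis t) <= 2 * `|s - t|.
Proof.
rewrite (le_trans (nrm_le_ReIm _))// mulr2n mulrDl !mul1r /cis/=.
apply: lerD.
  apply: (@derivative_le1_lipschitz cos (fun x => - sin x)) => x.
  by rewrite normrN ler_norml sin_geN1 sin_le1.
apply: (@derivative_le1_lipschitz sin cos) => x.
by rewrite ler_norml cos_geN1 cos_le1.
Qed.

Lemma circle_cis z : nrm z = 1 -> exists2 t, 0 <= t < 2 * pi & z = cis t.
Proof.
move=> z1; have := nrm_sqr z; rewrite z1 expr1n.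
case: z z1 => x y /= _ xy.
have x11 : -1 <= x <= 1.
  have : `|x| <= 1.
    by rewrite -(@ler_pXn2r _ 2)// ?nnegrE// expr1n real_normK ?num_real// xy lerDl sqr_ge0.
  by rewrite ler_norml.
have yE : y ^+ 2 = 1 - x ^+ 2 by rewrite xy addrAC subrr add0r.
have [y0|y0] := leP 0 y.
  exists (acos x).
    rewrite acos_ge0//= (le_lt_trans (acos_lepi x11))//.
    by rewrite ltr_pMl ?pi_gt0// ltr1n.
  rewrite /cis acosK ?in_itv//= sin_acos// -yE sqrtr_sqr ger0_norm//.
exists (2 * pi - acos x); last first.
  rewrite /cis mulr_natl cosB sinB cos2pi sin2pi acosK ?in_itv//= sin_acos//.
  by rewrite -yE sqrtr_sqr ltr0_norm// !mul0r mul1r addr0 sub0r mul1r opprK.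
have x1 : x < 1.
  rewrite lt_neqAle; case/andP: x11 => _ ->; rewrite andbT.
  apply/eqP => x1; move/eqP: yE; rewrite x1 expr1n subrr sqrf_eq0.
  by rewrite lt_eqF.
have xN1 : -1 <= x by case/andP: x11.
rewrite ltrBlDr ltrDl acos_gt0 ?xN1// andbT subr_ge0.
by rewrite (le_trans (acos_lepi x11))// ler_peMl ?pi_ge0// ler1n.
Qed.

Lemma open_ball_nrm c (r : R) : open [set z : C | nrm (z - c) < r].
Proof.
rewrite openE => z /= zr; apply/nbhs_nrmP; exists (r - nrm (z - c)).
  by rewrite subr_gt0.
by move=> y; rewrite ltrBrDr => h /=; rewrite (le_lt_trans _ h)// nrm_distD.
Qed.

(** The centres of the balls are taken in [K] itself, so that the distance to
    [K] bounds from below the distance to each centre. *)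
Lemma null_compact_cover K (e : R) : compact K -> K `<=` @circle R ->
    circle_negligible K -> 0 < e ->
  exists l : seq (C * R), [/\ {in l, forall p, K p.1 /\ 0 < p.2},
    \sum_(p <- l) p.2 <= e &
    forall c, K c -> exists2 p, p \in l & nrm (c - p.1) < p.2].
Proof.
move=> cK K1 K0 e0; have e40 : 0 < e / 4 by rewrite divr_gt0.
(* Intervals of total length [e / 4] contribute at most [e / 2], because of the
   Lipschitz constant 2 of [nrm_cis_sub]; the geometric terms, of total at most
   [e / 2], provide the strict inequalities needed for open balls. *)
have [I [I12 TI Isum]] := null_cover K0 e40.
pose eta n := 2 * ((I n).2 - (I n).1) + e / 4 * 2^-1 ^+ n.
have eta0 n : 0 < eta n.
  by rewrite ltr_wpDl ?mulr_ge0 ?subr_ge0// mulr_gt0// exprn_gt0// invr_gt0.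
pose D := [set n | exists2 t, t \in `](I n).1, (I n).2] & K (cis t)].
have /choice[t ht] n : exists t, D n -> t \in `](I n).1, (I n).2] /\ K (cis t).
  by have [[t h1 h2]|nD] := pselect (D n); [exists t|exists 0].
have : K `<=` cover D (fun n => [set z : C | nrm (z - cis (t n)) < eta n]).
  move=> z Kz; have z1 : nrm z = 1.
    by have := K1 _ Kz; rewrite /circle/= nrmE => /complexI.
  have [s s02 zs] := circle_cis z1; subst z.
  have [n _ sn] := TI s (conj s02 Kz).
  have Dn : D n by exists s.
  have [tn _] := ht n Dn; exists n => //=.
  rewrite (le_lt_trans (nrm_cis_sub _ _))// /eta.
  apply: (@le_lt_trans _ _ (2 * ((I n).2 - (I n).1))); last first.
    by rewrite ltrDl mulr_gt0// exprn_gt0// invr_gt0.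
  move: sn tn; rewrite /= !in_itv/= => /andP[s1 s2] /andP[t1 t2].
  by rewrite ler_pM2l// ler_norml; lra.
move: cK; rewrite compact_cover => cK Kcov.
have [|D' D'D KD'] := cK nat D _ _ Kcov.
  by move=> n _; exact: open_ball_nrm.
exists [seq (cis (t n), eta n) | n <- enum_fset D']; split.
- move=> _ /mapP[n nD' ->] /=; split=> //.
  by have := D'D _ nD'; move=> /set_mem/(ht n)[].
- rewrite big_map/=; pose N := (\max_(n <- enum_fset D') n).+1.
  apply: (@le_trans _ _ (\sum_(n < N) eta n)).
    rewrite -(big_mkord xpredT eta) /index_iota subn0.
    have -> : \sum_(n <- enum_fset D') eta n = \sum_(n <- iota 0 N | n \in D') eta n.
      rewrite -[RHS]big_filter; apply: perm_big; apply: uniq_perm.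
      - exact: fset_uniq.
      - by rewrite filter_uniq// iota_uniq.
      move=> n; rewrite mem_filter mem_iota/= add0n.
      have [nD'|//] := boolP (n \in D').
      rewrite /= ltnS; apply/esym.
      by apply: (@leq_bigmax_seq _ _ xpredT id).
    rewrite big_mkcond/=; apply: ler_sum => n _; case: ifP => // _.
    exact: ltW.
  rewrite big_split/= -mulr_sumr.
  have : \sum_(i < N) e / 4 * 2^-1 ^+ i <= 2 * (e / 4).
    rewrite -mulr_sumr mulrC ler_pM2r//.
    have := subrX1 (2^-1 : R) N; set S := \sum_(i < N) _ => h.
    have : 0 <= (2^-1 : R) ^+ N by rewrite exprn_ge0// invr_ge0.
    by move: h; lra.
  by have := Isum N; lra.
- move=> c /KD'[n /= nD' cn].
  by exists (cis (t n), eta n) => //; apply/mapP; exists n.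
Qed.

(** A Cauchy kernel with its pole at [(1 + p.2) * p.1], slightly outside the
    disk when [p.1] is on the circle, scaled by the distance to the pole. It
    replaces the Poisson integral of an arc: its real part is positive and is
    bounded below near [p.1], while its modulus is small far from [p.1]. *)
Definition bump (p : C * R) (z : C) : C :=
  (p.2)%:C / ((1 + p.2)%:C - p.1^*%C * z).

Section Bump.
Variables (c : C) (e : R).
Hypotheses (c1 : nrm c = 1) (e0 : 0 < e).

Let den z : C := (1 + e)%:C - c^*%C * z.

Lemma bump_den z : nrm z <= 1 ->
  [/\ e <= complex.Re (den z), nrm (z - c) <= nrm (den z),
      nrm (den z) ^+ 2 = e ^+ 2 + 2 * e * (complex.Re (den z) - e) + nrm (z - c) ^+ 2
    & 0 < nrm (den z)].
Proof.
move=> z1; pose w : C := 1 - c^*%C * z.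
have denE : den z = e%:C + w by rewrite /den rmorphD/= /w addrCA addrA.
have Rw : 0 <= complex.Re w.
  rewrite /w ReB subr_ge0 (le_trans (ler_norm _))// (le_trans (Re_le_nrm _))//.
  by rewrite nrmM nrm_conj c1 mul1r.
have wE : nrm w = nrm (z - c).
  rewrite nrmBC -[LHS]mul1r -c1 -nrmM /w mulrBr mulr1 mulrA mul_conj_nrm c1 expr1n.
  by rewrite mul1r.
have RE : complex.Re (den z) = e + complex.Re w by rewrite denE ReD.
have nE : nrm (den z) ^+ 2 = e ^+ 2 + 2 * e * (complex.Re (den z) - e) + nrm (z - c) ^+ 2.
  rewrite -wE !nrm_sqr RE denE ImD/= ReD/= add0r.
  by move: (complex.Re w) (complex.Im w) => x y; ring.
have Re_e : e <= complex.Re (den z) by rewrite RE lerDl.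
split=> //.
  rewrite -(@ler_pXn2r _ 2)// ?nnegrE ?nrm_ge0// nE lerDr.
  by rewrite addr_ge0 ?sqr_ge0// mulr_ge0 ?subr_ge0// mulr_ge0// ltW.
rewrite (lt_le_trans e0)// (le_trans Re_e)// (le_trans (ler_norm _))//.
exact: Re_le_nrm.
Qed.

Lemma Re_realM_inv (x : R) (d : C) :
  complex.Re (x%:C / d) = x * complex.Re d / nrm d ^+ 2.
Proof.
by rewrite nrm_sqr; case: d => a b /=; rewrite mul0r subr0 mulrA.
Qed.

Lemma Re_bump_ge0 z : nrm z <= 1 -> 0 <= complex.Re (bump (c, e) z).
Proof.
move=> /bump_den[h1 h2 h3 h4]; rewrite /bump/= Re_realM_inv.
by rewrite divr_ge0 ?sqr_ge0// mulr_ge0 ?(ltW e0)// (le_trans _ h1)// ltW.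
Qed.

Lemma Re_bump_near z : nrm z <= 1 -> nrm (z - c) < e ->
  2^-1 <= complex.Re (bump (c, e) z).
Proof.
move=> /bump_den[h1 h2 h3 h4] ze; rewrite /bump/= Re_realM_inv.
rewrite ler_pdivlMr ?exprn_gt0// h3.
have : nrm (z - c) ^+ 2 <= e ^+ 2 by rewrite lerXn2r ?nnegrE ?nrm_ge0 ?(ltW e0) ?(ltW ze).
rewrite /den in h1 *; move: (complex.Re _) h1 (nrm _ ^+ 2) => x h1 y; lra.
Qed.

Lemma nrm_bump_le z : nrm z <= 1 -> nrm (bump (c, e) z) * nrm (z - c) <= e.
Proof.
move=> /bump_den[h1 h2 h3 h4]; rewrite /bump/= nrmM nrmV nrm_real_ge0 ?(ltW e0)//.
rewrite -mulrA ler_piMr ?(ltW e0)// mulrC ler_pdivrMr// mul1r.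
exact: h2.
Qed.

Lemma bump_hol : hol (bump (c, e)).
Proof.
apply: holZ; apply: (@hol_inv_pos _ _ e) => //.
  by apply: holB; [exact: hol_cst|apply: holZ; exact: hol_id].
by move=> z /ltW/bump_den[].
Qed.

Lemma bump_lipschitz : exists2 B : R, 0 <= B & forall z z', nrm z <= 1 -> nrm z' <= 1 ->
  nrm (bump (c, e) z - bump (c, e) z') <= B * nrm (z - z').
Proof.
exists e^-1 => [|z z' /bump_den[h1 _ _ h4] /bump_den[h1' _ _ h4']].
  by rewrite invr_ge0 ltW.
have dz : den z != 0 by rewrite -nrm_gt0.
have dz' : den z' != 0 by rewrite -nrm_gt0.
rewrite /bump/= -/(den z) -/(den z').
have dd : den z' - den z = c^*%C * (z - z').
  by rewrite /den; move: ((1 + e)%:C) (c^*%C) => x y; ring.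
have -> : e%:C / den z - e%:C / den z' = e%:C * (den z' - den z) / (den z * den z').
  by move: (den z) (den z') (e%:C) dz dz' => x y t x0 y0; field; apply/andP.
have Re_le x : complex.Re (den x) <= nrm (den x).
  by rewrite (le_trans (ler_norm _))// Re_le_nrm.
rewrite dd !nrmM nrmV nrmM nrm_conj c1 mul1r nrm_real_ge0 ?(ltW e0)//.
rewrite ler_pdivrMr ?mulr_gt0// mulrAC ler_wpM2r ?nrm_ge0//.
rewrite ler_pdivlMl// -expr2 expr2; apply: ler_pM; rewrite ?(ltW e0)//.
  exact: le_trans h1 (Re_le _).
exact: le_trans h1' (Re_le _).
Qed.

End Bump.
End NullSets.

(** * A function that is infinite exactly on the given set *)

Section PeakFunction.
Variable R : realType.
Local Notation C := (Cplx R).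
Local Notation nrm := (@Normc.normc R).
Implicit Types (z c : C) (K : set C).

Lemma closed_separation K c : closed K -> ~ K c ->
  exists2 d : R, 0 < d & forall z, K z -> d <= nrm (z - c).
Proof.
move=> Kcl Kc; have : open (~` K) by exact: closed_openC.
rewrite openE => /(_ c Kc)/nbhs_nrmP[d d0 hd]; exists d => // z Kz.
by rewrite leNgt; apply/negP => /hd.
Qed.

(** The [m]-th function is a finite sum of bumps, one for each ball of a cover
    of [K] whose radii have sum at most [2^-m]. *)
Lemma boundary_bumps K : compact K -> K `<=` @circle R -> circle_negligible K ->
  exists Phi : nat -> C -> C,
  [/\ forall m, hol (Phi m),
      forall m z, nrm z <= 1 -> 0 <= complex.Re (Phi m z),
      forall m z (d : R), nrm z <= 1 -> (forall c, K c -> d <= nrm (c - z)) ->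
        nrm (Phi m z) * d <= 2^-1 ^+ m,
      forall m, exists2 B : R, 0 <= B & forall z z', nrm z <= 1 -> nrm z' <= 1 ->
        nrm (Phi m z - Phi m z') <= B * nrm (z - z') &
      forall m c, K c -> exists2 d : R, 0 < d &
        forall z, nrm z <= 1 -> nrm (z - c) < d -> 2^-1 <= complex.Re (Phi m z)].
Proof.
move=> cK K1 K0.
have e0 m : 0 < (2^-1 : R) ^+ m by rewrite exprn_gt0 ?invr_gt0.
have /choice[l hl] m := null_compact_cover cK K1 K0 (e0 m).
have lK m p : p \in l m -> [/\ nrm p.1 = 1, 0 < p.2 & K p.1].
  move=> pl; have [/(_ p pl)[Kp p0] _ _] := hl m; split=> //.
  by have := K1 _ Kp; rewrite /circle/= nrmE => /complexI.
have bumpE (p : C * R) : bump p = bump (p.1, p.2) by [].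
exists (fun m z => \sum_(p <- l m) bump p z); split.
- move=> m; have := lK m; elim: (l m) => [_|p s ih sK].
    by apply: hol_eq (hol_cst 0) => z _; rewrite big_nil.
  have [p1 p0 _] := sK p (mem_head _ _).
  have ih' := ih (fun q qs => sK q (mem_behead (s := p :: s) qs)).
  by apply: hol_eq (holD (bump_hol p1 p0) ih') => z _; rewrite big_cons.
- move=> m z z1; rewrite Re_sum big_seq sumr_ge0// => p /lK[p1 p0 _].
  exact: Re_bump_ge0 p1 p0 z z1.
- move=> m z d z1 hd; have [_ le _] := hl m; apply: le_trans le.
  have [d0|d0] := leP d 0.
    apply: (@le_trans _ _ 0); first by rewrite mulr_ge0_le0 ?nrm_ge0.
    by rewrite big_seq sumr_ge0// => p /lK[_ /ltW].
  apply: (@le_trans _ _ ((\sum_(p <- l m) nrm (bump p z)) * d)).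
    by rewrite ler_wpM2r ?(ltW d0)// nrm_sum.
  rewrite mulr_suml big_seq [leRHS]big_seq; apply: ler_sum => p /lK[p1 p0 Kp].
  apply: le_trans (nrm_bump_le p1 p0 z1).
  by rewrite ler_wpM2l ?nrm_ge0// nrmBC hd.
- move=> m; have := lK m; elim: (l m) => [_|p s ih sK].
    by exists 0 => // z z' _ _; rewrite !big_nil subrr nrm0 mul0r.
  have [p1 p0 _] := sK p (mem_head _ _).
  have [B B0 hB] := ih (fun q qs => sK q (mem_behead (s := p :: s) qs)).
  have [B' B'0 hB'] := bump_lipschitz p1 p0.
  exists (B' + B) => [|z z' z1 z1']; first exact: addr_ge0.
  rewrite !big_cons opprD addrACA mulrDl (le_trans (nrmD _ _))// lerD//.
    exact: hB'.
  exact: hB.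
- move=> m c Kc; have [_ _ /(_ c Kc)[p pl cp]] := hl m.
  have [p1 p0 _] := lK m p pl.
  exists (p.2 - nrm (c - p.1)); first by rewrite subr_gt0.
  move=> z z1; rewrite ltrBrDr => zc.
  rewrite Re_sum (perm_big _ (perm_to_rem pl)) big_cons/=.
  have h : 2^-1 <= complex.Re (bump p z).
    by apply: (Re_bump_near p1 p0 z1); rewrite (le_lt_trans (nrm_distD c _ _)).
  rewrite (le_trans h)// lerDl big_seq sumr_ge0// => q /mem_rem/lK[q1 q0 _].
  exact: Re_bump_ge0 q1 q0 z z1.
Qed.

(** This is Fatou's construction: near a point of [K], arbitrarily many terms
    of the sum of the [Phi m] have real part at least 1/2, whereas away from
    [K] the sum converges uniformly, because the [m]-th term is at most
    [2^-m] divided by the distance to [K]. *)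
Lemma peak_function K : compact K -> K `<=` @circle R -> circle_negligible K ->
  exists G : C -> C, [/\ hol G,
    forall z, nrm z <= 1 -> ~ K z -> 1 <= complex.Re (G z),
    forall c (e : R), nrm c <= 1 -> ~ K c -> 0 < e -> exists2 d : R, 0 < d &
      forall z, nrm z <= 1 -> nrm (z - c) < d ->
        ~ K z /\ nrm (G z - G c) <= e &
    forall c (M : R), K c -> exists2 d : R, 0 < d &
      forall z, nrm z <= 1 -> ~ K z -> nrm (z - c) < d -> M <= complex.Re (G z)].
Proof.
move=> cK K1 K0; have [Phi [Phi_hol Phi_ge0 Phi_le Phi_lip Phi_near]] := boundary_bumps cK K1 K0.
have Kcl : closed K by apply: compact_closed => //; exact: norm_hausdorff.
have half01 : 0 <= (2^-1 : R) < 1 by rewrite invr_ge0 ler0n invf_lt1// ltr1n.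
have dom z d : nrm z <= 1 -> 0 < d -> (forall c, K c -> d <= nrm (c - z)) ->
    forall m, nrm (Phi m z) <= d^-1 * 2^-1 ^+ m.
  by move=> z1 d0 hd m; rewrite mulrC ler_pdivlMr// Phi_le.
have sum_cvg z : nrm z <= 1 -> ~ K z -> series (Phi^~ z) @ \oo --> csum (Phi^~ z).
  move=> z1 Kz; have [d d0 hd] := closed_separation Kcl Kz.
  by have [] := geometric_domination half01 (dom z d z1 d0 hd).
have Re_ge z n : nrm z <= 1 -> ~ K z ->
    \sum_(m < n) complex.Re (Phi m z) <= complex.Re (csum (Phi^~ z)).
  move=> z1 Kz; have h := cvgC_Re (sum_cvg z z1 Kz).
  rewrite -(cvg_lim _ h)//; apply: limr_ge; first by apply/cvg_ex; eexists; exact: h.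
  exists n => // k /= nk; rewrite /series/= big_mkord Re_sum.
  rewrite (big_ord_widen _ (fun m => complex.Re (Phi m z)) nk).
  rewrite [leRHS](bigID (fun m : 'I_k => (m < n)%N))/= lerDl.
  by rewrite sumr_ge0// => i _; exact: Phi_ge0.
exists (fun z => 1 + csum (Phi^~ z)); split.
- apply: holD; first exact: hol_cst.
  apply: hol_csum => // r /andP[r0 r1]; exists (1 - r)^-1, 2^-1 => // m z zr.
  have z1 : nrm z <= 1 by rewrite (le_trans zr)// ltW.
  apply: (dom z (1 - r)) => //; first by rewrite subr_gt0.
  move=> c /K1; rewrite /circle/= nrmE => /complexI c1.
  by have := nrm_sub_ge c z; rewrite c1; lra.
- move=> z z1 Kz; rewrite ReD/= lerDl.
  by have := Re_ge z 0%N z1 Kz; rewrite big_ord0.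
- move=> c e c1 Kc e0; have [d d0 hd] := closed_separation Kcl Kc.
  have d20 : 0 < d / 2 by rewrite divr_gt0.
  have e30 : 0 < e / 3 by rewrite divr_gt0.
  have hd2 z : nrm (z - c) < d / 2 -> forall x, K x -> d / 2 <= nrm (x - z).
    by move=> zc x /hd; have := nrm_distD z x c; lra.
  have [n hn] := @geometric_small _ ((d / 2)^-1 / (1 - 2^-1)) _ _ half01 e30.
  have [B B0 hB] : exists2 B : R, 0 <= B & forall z z', nrm z <= 1 -> nrm z' <= 1 ->
      nrm (series (Phi^~ z) n - series (Phi^~ z') n) <= B * nrm (z - z').
    have /choice[B hB] m : exists B : R, 0 <= B /\ forall z z', nrm z <= 1 -> nrm z' <= 1 ->
        nrm (Phi m z - Phi m z') <= B * nrm (z - z').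
      by have [B B0 hB] := Phi_lip m; exists B.
    exists (\sum_(m < n) B m); first by apply: sumr_ge0 => m _; have [] := hB m.
    move=> z z' z1 z1'; rewrite /series/= !big_mkord -sumrB mulr_suml.
    rewrite (le_trans (nrm_sum _ _ _))// ler_sum// => m _.
    by have [_] := hB m; exact.
  have B10 : 0 < B + 1 by rewrite ltr_wpDl.
  exists (Num.min (d / 2) (e / 3 / (B + 1))); first by rewrite lt_min d20 divr_gt0.
  move=> z z1; rewrite lt_min => /andP[zd ze]; split.
    by move=> Kz; have := hd2 z zd z Kz; rewrite subrr nrm0; lra.
  have tail z' : nrm z' <= 1 -> nrm (z' - c) < d / 2 ->
      nrm (csum (Phi^~ z') - series (Phi^~ z') n) <= e / 3.
    move=> z'1 z'd; have [_ h] := geometric_domination half01 (dom z' _ z'1 d20 (hd2 z' z'd)).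
    by rewrite (le_trans (h n))// mulrAC hn.
  have t1 := tail z z1 zd.
  have t2 : nrm (csum (Phi^~ c) - series (Phi^~ c) n) <= e / 3.
    by apply: tail => //; rewrite subrr nrm0.
  have t3 : nrm (series (Phi^~ z) n - series (Phi^~ c) n) <= e / 3.
    rewrite (le_trans (hB _ _ z1 c1))//.
    rewrite (@le_trans _ _ ((B + 1) * nrm (z - c)))//.
      by rewrite ler_wpM2r ?nrm_ge0// lerDl.
    by rewrite mulrC -ler_pdivlMr// ltW.
  rewrite opprD addrACA subrr add0r.
  have := nrm_distD (series (Phi^~ z) n) (csum (Phi^~ z)) (csum (Phi^~ c)).
  have := nrm_distD (series (Phi^~ c) n) (series (Phi^~ z) n) (csum (Phi^~ c)).
  by rewrite (nrmBC (series (Phi^~ c) n) (csum (Phi^~ c))); lra.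
- move=> c M Kc.
  pose n := (Num.truncn (2 * M)).+1.
  have Mn : M <= n%:R * 2^-1.
    have : 2 * M < n%:R by rewrite /n truncnS_gt.
    by lra.
  have [d d0 hd] : exists2 d : R, 0 < d & forall m z, (m < n)%N -> nrm z <= 1 ->
      nrm (z - c) < d -> 2^-1 <= complex.Re (Phi m z).
    elim: n {Mn} => [|n [d d0 ih]]; first by exists 1.
    have [d' d'0 hd'] := Phi_near n c Kc.
    exists (Num.min d d'); first by rewrite lt_min d0.
    move=> m z; rewrite ltnS leq_eqVlt => /predU1P[->|mn] z1; rewrite lt_min => /andP[zd zd'].
      exact: hd'.
    exact: ih.
  exists d => // z z1 Kz zd; rewrite ReD/= (le_trans Mn)//.
  rewrite ler_wpDl// (le_trans _ (Re_ge z n z1 Kz))//.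
  rewrite (@le_trans _ _ (\sum_(m < n) 2^-1))//.
    by rewrite sumr_const card_ord mulr_natl.
  by apply: ler_sum => m _; exact: hd.
Qed.

End PeakFunction.

(** * A rational substitute for the logarithm *)

Section LogarithmicSum.
Variable R : realType.
Local Notation C := (Cplx R).
Local Notation nrm := (@Normc.normc R).
Implicit Types (g z c : C) (x a : R).

(** For [x = 1] this grows like the logarithm of [g] in base 2, as the [j]-th
    term passes from about 1 to about 0 when [2 ^+ j] passes [|g|]; for
    [1 < x < 2] it grows like a fractional power of [g]. It is an explicit
    series of rational functions, with no branch to choose. *)
Definition logsum (x : R) (g : C) : C :=
  csum (fun j => (x ^+ j)%:C * (g / ((2 ^+ j)%:C + g))).

Lemma real_complex_neq0 a : a != 0 -> (a%:C : C) != 0.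
Proof. by move=> a0; rewrite eq_complex/= eqxx andbT. Qed.

Lemma logsum_denom a g : 0 < a -> 0 <= complex.Re g ->
  [/\ a%:C + g != 0, a <= nrm (a%:C + g) &
      a ^+ 2 + nrm g ^+ 2 <= nrm (a%:C + g) ^+ 2].
Proof.
move=> a0 g0; have RE : complex.Re (a%:C + g) = a + complex.Re g by rewrite ReD.
have h : a <= nrm (a%:C + g).
  by rewrite (le_trans _ (Re_le_nrm _))// (le_trans _ (ler_norm _))// RE lerDl.
split=> //; first by rewrite -nrm_gt0 (lt_le_trans a0).
rewrite !nrm_sqr RE ImD/= add0r; have := mulr_ge0 (ltW a0) g0.
by move: (complex.Re g) (complex.Im g) => u v; nra.
Qed.

Lemma Re_quotient a g : 0 < a -> 0 <= complex.Re g ->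
  complex.Re (g / (a%:C + g)) = (nrm g ^+ 2 + a * complex.Re g) / nrm (a%:C + g) ^+ 2.
Proof.
move=> a0 g0; rewrite !nrm_sqr; case: g g0 => u v /= _.
by rewrite add0r; set n2 := (_ ^+ 2 + _ ^+ 2)^-1; ring.
Qed.

Lemma Im_quotient a g : 0 < a -> 0 <= complex.Re g ->
  complex.Im (g / (a%:C + g)) = a * complex.Im g / nrm (a%:C + g) ^+ 2.
Proof.
move=> a0 g0; rewrite !nrm_sqr; case: g g0 => u v /= _.
by rewrite add0r; set n2 := (_ ^+ 2 + _ ^+ 2)^-1; ring.
Qed.

Lemma Re_quotient_itv a g : 0 < a -> 0 <= complex.Re g ->
  0 <= complex.Re (g / (a%:C + g)) <= 1.
Proof.
move=> a0 g0; have [h1 h2 h3] := logsum_denom a0 g0; rewrite Re_quotient//.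
have d0 : 0 < nrm (a%:C + g) ^+ 2 by rewrite exprn_gt0// nrm_gt0.
have ag0 : 0 <= a * complex.Re g by rewrite mulr_ge0// ltW.
rewrite divr_ge0 ?addr_ge0 ?sqr_ge0//= ler_pdivrMr// mul1r.
rewrite !nrm_sqr ReD ImD/= add0r.
have := sqr_ge0 a.
by move: ag0; move: (complex.Re g) (complex.Im g) => u v; nra.
Qed.

Lemma Re_quotient_large a g : 0 < a -> 0 <= complex.Re g -> a <= nrm g ->
  4^-1 <= complex.Re (g / (a%:C + g)).
Proof.
move=> a0 g0 ag; have [h1 h2 h3] := logsum_denom a0 g0; rewrite Re_quotient//.
have d0 : 0 < nrm (a%:C + g) ^+ 2 by rewrite exprn_gt0// nrm_gt0.
have ag0 : 0 <= a * complex.Re g by rewrite mulr_ge0// ltW.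
rewrite ler_pdivlMr// ler_pdivrMl ?ltr0n//.
have : nrm (a%:C + g) ^+ 2 <= (nrm g + nrm g) ^+ 2.
  rewrite lerXn2r ?nnegrE ?addr_ge0 ?nrm_ge0// (le_trans (nrmD _ _))// lerD2r.
  by rewrite nrm_real_ge0 ?(ltW a0).
by move: (nrm g) (nrm _) => u v; nra.
Qed.

(** The imaginary part is at most of order [min (a / |g|, |g| / a)], and this
    form of the bound telescopes along the powers of 2, which keeps the imaginary part of
    [logsum 1] bounded. *)
Lemma Im_quotient_le a g : 0 < a -> 0 <= complex.Re g -> 0 < nrm g ->
  `|complex.Im (g / (a%:C + g))| <=
  4 * (2 * a / (2 * a + nrm g) - a / (a + nrm g)).
Proof.
move=> a0 g0 n0; have [h1 h2 h3] := logsum_denom a0 g0; rewrite Im_quotient//.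
have d0 : 0 < nrm (a%:C + g) ^+ 2 by rewrite exprn_gt0// nrm_gt0.
rewrite !normrM (gtr0_norm a0) normfV (gtr0_norm d0).
apply: (@le_trans _ _ (a * nrm g / (a ^+ 2 + nrm g ^+ 2))).
  rewrite -!mulrA ler_pM2l// ler_pM ?invr_ge0 ?(ltW d0) ?Im_le_nrm//.
  by rewrite lef_pV2 ?posrE ?d0 ?addr_gt0 ?exprn_gt0.
move: (nrm g) n0 => y y0.
have e : 4 * (2 * a / (2 * a + y) - a / (a + y)) =
    4 * a * y / ((2 * a + y) * (a + y)).
  by field; apply/andP; split; lra.
have p1 : 0 < (2 * a + y) * (a + y) by rewrite mulr_gt0//; lra.
have p2 : 0 < a ^+ 2 + y ^+ 2 by rewrite addr_gt0 ?exprn_gt0.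
rewrite e ler_pdivrMr// mulrAC ler_pdivlMr//.
have ay : 0 < a * y by rewrite mulr_gt0.
rewrite [leRHS](_ : _ = (a * y) * (4 * (a ^+ 2 + y ^+ 2))); last by ring.
rewrite ler_pM2l//.
have := sqr_ge0 (a - y); have := sqr_ge0 a; have := sqr_ge0 y.
by nra.
Qed.

Section Values.
Variables (x : R) (g : C).
Hypotheses (x12 : 1 <= x < 2) (g1 : 1 <= complex.Re g).

Let u j : C := (x ^+ j)%:C * (g / ((2 ^+ j)%:C + g)).
Let t j : R := complex.Re (g / ((2 ^+ j)%:C + g)).

Let g0 : 0 <= complex.Re g. Proof. exact: le_trans ler01 g1. Qed.
Let p2 j : 0 < (2 : R) ^+ j. Proof. by rewrite exprn_gt0. Qed.
Let x0 : 0 < x. Proof. by have /andP[x1 _] := x12; exact: lt_le_trans x1. Qed.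

Lemma logsum_term_le j : nrm (u j) <= nrm g * (x / 2) ^+ j.
Proof.
have [h1 h2 _] := logsum_denom (p2 j) g0.
rewrite /u !nrmM nrmV nrm_real_ge0 ?exprn_ge0 ?(ltW x0)// mulrCA ler_wpM2l ?nrm_ge0//.
by rewrite expr_div_n ler_wpM2l ?exprn_ge0 ?(ltW x0)// lef_pV2 ?posrE ?nrm_gt0.
Qed.

Lemma logsum_ratio : 0 <= x / 2 < 1.
Proof. by have /andP[x1 x2] := x12; rewrite divr_ge0 ?(ltW x0)//= ltr_pdivrMr// mul1r. Qed.

Lemma logsum_cvg : series u @ \oo --> logsum x g.
Proof. by have [] := geometric_domination logsum_ratio logsum_term_le. Qed.

Lemma Re_logsum_ge n : \sum_(j < n) x ^+ j * t j <= complex.Re (logsum x g).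
Proof.
have h := cvgC_Re logsum_cvg.
rewrite -(cvg_lim _ h)//; apply: limr_ge; first by apply/cvg_ex; eexists; exact: h.
exists n => // k /= nk; rewrite /series/= big_mkord Re_sum.
rewrite (big_ord_widen _ (fun j => x ^+ j * t j) nk).
rewrite [leRHS](bigID (fun m : 'I_k => (m < n)%N))/=.
rewrite (eq_bigr (fun j : 'I_k => complex.Re (u j))).
  rewrite lerDl sumr_ge0// => i _; rewrite ReZ mulr_ge0 ?exprn_ge0 ?(ltW x0)//.
  by have /andP[] := Re_quotient_itv (p2 i) g0.
by move=> i _; rewrite ReZ.
Qed.

End Values.

Variable g : C.
Hypothesis g1 : 1 <= complex.Re g.

Let g0 : 0 <= complex.Re g. Proof. exact: le_trans ler01 g1. Qed.
Let p2 j : 0 < (2 : R) ^+ j. Proof. by rewrite exprn_gt0. Qed.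
Let one12 : 1 <= (1 : R) < 2. Proof. by rewrite lexx ltr1n. Qed.

Lemma Im_logsum1_le : `|complex.Im (logsum 1 g)| <= 4.
Proof.
have h := cvgC_Im (logsum_cvg one12 g1).
have n0 : 0 < nrm g.
  by rewrite (lt_le_trans ltr01)// (le_trans g1)// (le_trans (ler_norm _))// Re_le_nrm.
pose hh (a : R) := a / (a + nrm g).
have hh01 n : 0 <= hh (2 ^+ n) <= 1.
  have pn := p2 n; rewrite /hh divr_ge0 ?addr_ge0 ?nrm_ge0 ?(ltW pn)//=.
  by rewrite ler_pdivrMr ?addr_gt0// mul1r lerDl ltW.
have bound n : `|complex.Im (series (fun j => (1 ^+ j)%:C * (g / ((2 ^+ j)%:C + g))) n)| <= 4.
  rewrite /series/= Im_sum (le_trans (ler_norm_sum _ _ _))//.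
  apply: (@le_trans _ _ (\sum_(0 <= i < n) 4 * (hh (2 ^+ i.+1) - hh (2 ^+ i)))).
    apply: ler_sum => i _; rewrite expr1n mul1r /hh exprS.
    exact: Im_quotient_le.
  rewrite -mulr_sumr telescope_sumr// ler_piMr//.
  by have /andP[_ h1] := hh01 n; have /andP[h2 _] := hh01 0%N; lra.
rewrite ler_norml -!(cvg_lim _ h)//; apply/andP; split.
  apply: limr_ge; first by apply/cvg_ex; eexists; exact: h.
  by apply: nearW => n; have := bound n; rewrite ler_norml => /andP[].
apply: limr_le; first by apply/cvg_ex; eexists; exact: h.
by apply: nearW => n; have := bound n; rewrite ler_norml => /andP[].
Qed.

Lemma Re_logsum1_large n : 2 ^+ n <= nrm g -> n%:R / 4 <= complex.Re (logsum 1 g).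
Proof.
move=> gn; apply: le_trans (Re_logsum_ge one12 g1 n).
rewrite (@le_trans _ _ (\sum_(j < n) 4^-1))//.
  by rewrite sumr_const card_ord mulr_natl.
apply: ler_sum => j _; rewrite expr1n mul1r; apply: Re_quotient_large => //.
by rewrite (le_trans _ gn)// ler_eXn2l ?ltr1n// ltnW.
Qed.

(** The real parts of the terms lie in [0, 1], so that a large value of
    [logsum 1] forces many terms to be non negligible, and hence an
    exponentially large value of [logsum x] for [x > 1]. *)
Lemma Re_logsum1_le x m : 1 <= x < 2 ->
  complex.Re (logsum 1 g) <= m%:R + x ^- m * complex.Re (logsum x g).
Proof.
move=> x12; have /andP[x1 x2] := x12; have x0 : 0 < x by apply: lt_le_trans x1.
have h := cvgC_Re (logsum_cvg one12 g1); rewrite -(cvg_lim _ h)//.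
apply: limr_le; first by apply/cvg_ex; eexists; exact: h.
apply: nearW => n; rewrite /series/= big_mkord Re_sum.
pose t j : R := complex.Re (g / ((2 ^+ j)%:C + g)).
have t01 j : 0 <= t j <= 1 by exact: Re_quotient_itv.
have xm0 : 0 < x ^- m by rewrite invr_gt0 exprn_gt0.
apply: (@le_trans _ _ (\sum_(j < n) ((j < m)%N%:R + x ^- m * (x ^+ j * t j)))).
  apply: ler_sum => j _; rewrite expr1n mul1r -/(t j).
  have /andP[t0 t1] := t01 j; have [jm|mj] := ltnP j m.
    by rewrite (le_trans t1)// lerDl mulr_ge0 ?(ltW xm0)// mulr_ge0 ?exprn_ge0 ?(ltW x0).
  rewrite add0r mulrA ler_peMl// mulrC ler_pdivlMr ?exprn_gt0// mul1r.
  by rewrite ler_weXn2l.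
rewrite big_split/= -mulr_sumr lerD//.
  have cnt k : (\sum_(j < k) (j < m) = minn k m)%N.
    elim: k => [|k ih]; first by rewrite big_ord0 min0n.
    by rewrite big_ord_recr/= ih; case: ltnP; lia.
  by rewrite -natr_sum ler_nat cnt geq_minr.
by rewrite ler_pM2l// Re_logsum_ge.
Qed.

Lemma logsum1_lipschitz g' : 1 <= complex.Re g' ->
  nrm (logsum 1 g - logsum 1 g') <= 2 * nrm (g - g').
Proof.
move=> g1'; have g0' : 0 <= complex.Re g' by exact: le_trans ler01 g1'.
have h : (series (fun j => (1 ^+ j)%:C * (g / ((2 ^+ j)%:C + g))) -
    series (fun j => (1 ^+ j)%:C * (g' / ((2 ^+ j)%:C + g'))) : nat -> C) @ \oo -->
    logsum 1 g - logsum 1 g'.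
  by apply: cvgB; [exact: logsum_cvg one12 g1|exact: logsum_cvg one12 g1'].
have hn := cvgC_norm h; rewrite -(cvg_lim _ hn)//.
apply: limr_le; first by apply/cvg_ex; eexists; exact: hn.
apply: nearW => n; rewrite /series/= !fctE/= -sumrB big_mkord.
rewrite (le_trans (nrm_sum _ _ _))//.
apply: (@le_trans _ _ (\sum_(j < n) 2^-1 ^+ j * nrm (g - g'))).
  apply: ler_sum => j _; rewrite expr1n !mul1r.
  have [d1 h1 _] := logsum_denom (p2 j) g0.
  have [d2 h2 _] := logsum_denom (p2 j) g0'.
  have -> : g / ((2 ^+ j)%:C + g) - g' / ((2 ^+ j)%:C + g') =
      (2 ^+ j)%:C * (g - g') / (((2 ^+ j)%:C + g) * ((2 ^+ j)%:C + g')).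
    by move: d1 d2; move: ((2 ^+ j)%:C) => a d1 d2; field; apply/andP.
  rewrite !nrmM nrmV nrmM nrm_real_ge0 ?(ltW (p2 j))// mulrAC ler_wpM2r ?nrm_ge0//.
  rewrite ler_pdivrMr ?mulr_gt0 ?nrm_gt0// exprVn ler_pdivlMl//.
  by rewrite ler_pM ?(ltW (p2 j)).
rewrite -mulr_suml ler_wpM2r ?nrm_ge0//.
have := subrX1 (2^-1 : R) n; set S := \sum_(i < n) _ => hS.
have : 0 <= (2^-1 : R) ^+ n by rewrite exprn_ge0// invr_ge0.
by move: hS; lra.
Qed.

End LogarithmicSum.

Lemma hol_logsum (R : realType) (x : R) (G : Cplx R -> Cplx R) : 1 <= x < 2 ->
    hol G -> (forall z, Normc.normc z < 1 -> 1 <= complex.Re (G z)) ->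
  hol (fun z => logsum x (G z)).
Proof.
move=> x12 hG G1.
apply: (@hol_csum _ (fun j z => (x ^+ j)%:C * (G z / ((2 ^+ j)%:C + G z)))).
  move=> j; apply: holZ; apply: holM => //; apply: (@hol_inv_pos _ _ 1) => //.
    by apply: holD => //; exact: hol_cst.
  by move=> z /G1 h; rewrite ReD/= ler_wpDl// exprn_ge0.
move=> r /andP[r0 r1]; have [M M0 hM] := hol_bounded hG r1.
exists M, (x / 2); first exact: logsum_ratio x12.
move=> j z zr; have z1 := le_lt_trans zr r1.
rewrite (le_trans (logsum_term_le x12 (G1 z z1) j))// ler_wpM2r ?hM//.
by rewrite exprn_ge0//; have /andP[] := logsum_ratio x12.
Qed.


(** * The cusp *)

Section CuspRegion.
Variable R : realType.
Local Notation C := (Cplx R).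
Local Notation nrm := (@Normc.normc R).
Implicit Types (l w : C).

(** It maps the half plane [1 / 2 < Re l] onto the disk, and the half strip
    where [1 <= Re l] and [Im l] is bounded onto a region that narrows to the
    point 1 between two circles tangent to the real axis. *)
Definition cusp (l : C) : C := 1 - l^-1.

Section InHalfStrip.
Variable l : C.
Hypotheses (Re1 : 1 <= complex.Re l) (Im4 : `|complex.Im l| <= 4).

Let Im16 : complex.Im l ^+ 2 <= 16.
Proof.
rewrite -[X in X <= _]real_normK ?num_real// (_ : 16 = 4 ^+ 2); last by ring.
by rewrite lerXn2r ?nnegrE.
Qed.

Let n1 : 1 <= nrm l.
Proof. by rewrite (le_trans Re1)// (le_trans (ler_norm _))// Re_le_nrm. Qed.

Let n0 : 0 < nrm l. Proof. exact: lt_le_trans n1. Qed.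

Let l0 : l != 0. Proof. by rewrite -nrm_gt0. Qed.

Lemma cusp_defect : 1 - nrm (cusp l) ^+ 2 = (2 * complex.Re l - 1) / nrm l ^+ 2.
Proof.
have -> : cusp l = (l - 1) / l by rewrite /cusp mulrBl divff// mul1r.
rewrite nrmM nrmV exprMn exprVn.
have e : nrm (l - 1) ^+ 2 = nrm l ^+ 2 - 2 * complex.Re l + 1.
  by rewrite !nrm_sqr ReB ImD/=; move: (complex.Re l) (complex.Im l) => x y; ring.
have n20 : nrm l ^+ 2 != 0 by rewrite gt_eqF// exprn_gt0.
by rewrite e; move: (nrm l ^+ 2) n20 => a a0; field.
Qed.

Lemma cusp_defect_ge : (nrm l ^+ 2)^-1 <= 1 - nrm (cusp l) ^+ 2.
Proof.
rewrite cusp_defect -[leLHS]mul1r ler_pM2r ?invr_gt0 ?exprn_gt0//.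
by move: Re1; lra.
Qed.

Lemma nrm_cusp_lt1 : nrm (cusp l) < 1.
Proof.
have : 0 < 1 - nrm (cusp l) ^+ 2.
  by rewrite (lt_le_trans _ cusp_defect_ge)// invr_gt0 exprn_gt0.
by rewrite subr_gt0 expr_lt1 ?nrm_ge0.
Qed.

(** The half strip is mapped to a cusp at 1, where the kernel
    [1 / (1 - |w| ^+ 2)] grows only like the real part of [l]. *)
Lemma cusp_kernel_le : 1 <= 17 * complex.Re l * (1 - nrm (cusp l) ^+ 2).
Proof.
rewrite cusp_defect mulrA ler_pdivlMr ?exprn_gt0// mul1r nrm_sqr.
by move: Re1 Im16; move: (complex.Re l) (complex.Im l ^+ 2) => x y; nra.
Qed.

Lemma blaschke_cusp (t : R) : 0 < t -> l + (t%:C - 1) != 0 ->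
  blaschke (1 - t^-1) (cusp l) = (l - t%:C) / (l + (t%:C - 1)).
Proof.
move=> t0 d0; have tn : (t%:C : C) != 0 by rewrite real_complex_neq0// gt_eqF.
rewrite /blaschke /cusp.
have -> : ((1 - t^-1)%:C : C) = 1 - (t%:C)^-1 by rewrite rmorphB fmorphV.
have -> : 1 - l^-1 - (1 - (t%:C)^-1) = (l - t%:C) / (l * t%:C).
  by move: tn; move: (t%:C) => u u0; field; apply/andP.
have -> : 1 - (1 - (t%:C)^-1) * (1 - l^-1) = (l + (t%:C - 1)) / (l * t%:C).
  by move: tn; move: (t%:C) => u u0; field; apply/andP.
by rewrite invf_div mulrA divfK// mulf_neq0.
Qed.

(** The points [t] and [l] of the half strip are at bounded hyperbolic distance
    for the half plane that [cusp] maps onto the disk, so that one zero for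
    each dyadic block of real parts suffices. *)
Lemma nrm_blaschke_cusp_le (t : R) : 1 <= t -> t <= complex.Re l <= 2 * t ->
  nrm (blaschke (1 - t^-1) (cusp l)) ^+ 2 <= 24 / 25.
Proof.
move=> t1 /andP[tl lt]; have t0 : 0 < t by apply: lt_le_trans t1.
have ReE : complex.Re (l + (t%:C - 1)) = complex.Re l + t - 1 by rewrite ReD ReB/= addrA.
have d0 : l + (t%:C - 1) != 0.
  by apply/eqP => h; move: ReE; rewrite h/=; move: Re1; lra.
rewrite blaschke_cusp// nrmM nrmV exprMn exprVn ler_pdivrMr ?exprn_gt0 ?nrm_gt0//.
rewrite !nrm_sqr ReE ReB !ImD !ImN/= ?oppr0 ?subr0 ?addr0 ?oppr0 ?addr0.
by move: tl lt Re1 Im16; move: (complex.Re l) (complex.Im l ^+ 2) => x y; nra.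
Qed.

End InHalfStrip.

Lemma cusp_lipschitz l l' : 1 <= nrm l -> 1 <= nrm l' ->
  nrm (cusp l - cusp l') <= nrm (l - l').
Proof.
move=> l1 l1'; have l0 : l != 0 by rewrite -nrm_gt0 (lt_le_trans ltr01).
have l0' : l' != 0 by rewrite -nrm_gt0 (lt_le_trans ltr01).
have -> : cusp l - cusp l' = (l - l') / (l * l').
  by rewrite /cusp; field; apply/andP.
rewrite nrmM nrmV nrmM ler_pdivrMr ?mulr_gt0 ?nrm_gt0// ler_peMr ?nrm_ge0//.
exact: mulr_ege1.
Qed.

End CuspRegion.

(** * The symbol of the composition operator *)

Section Symbol.
Variable R : realType.
Local Notation C := (Cplx R).
Local Notation nrm := (@Normc.normc R).
Implicit Types (z c : C).
Variables (K : set C) (G : C -> C).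
Hypothesis K_circle : K `<=` @circle R.
Hypothesis G_hol : hol G.
Hypothesis G_ge1 : forall z, nrm z <= 1 -> ~ K z -> 1 <= complex.Re (G z).
Hypothesis G_cont : forall c (e : R), nrm c <= 1 -> ~ K c -> 0 < e ->
  exists2 d : R, 0 < d & forall z, nrm z <= 1 -> nrm (z - c) < d ->
    ~ K z /\ nrm (G z - G c) <= e.
Hypothesis G_peak : forall c (M : R), K c -> exists2 d : R, 0 < d &
  forall z, nrm z <= 1 -> ~ K z -> nrm (z - c) < d -> M <= complex.Re (G z).

(** The coordinate in the half strip; it tends to infinity at the points of [K]. *)
Definition height z : C := 1 + logsum 1 (G z).

Definition symbol z : C := if `[< K z >] then 1 else cusp (height z).

Let one12 : 1 <= (1 : R) < 2. Proof. by rewrite lexx ltr1n. Qed.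

Lemma disk_notin z : nrm z < 1 -> ~ K z.
Proof.
by move=> z1 /K_circle; rewrite /circle/= nrmE => /complexI e; rewrite e ltxx in z1.
Qed.

Lemma symbol_disk z : nrm z < 1 -> symbol z = cusp (height z).
Proof. by move=> /disk_notin Kz; rewrite /symbol asboolF. Qed.

Lemma height_strip z : nrm z <= 1 -> ~ K z ->
  1 <= complex.Re (height z) /\ `|complex.Im (height z)| <= 4.
Proof.
move=> z1 Kz; have g1 := G_ge1 z1 Kz; rewrite /height ReD ImD/= add0r; split.
  by rewrite lerDl; have := Re_logsum_ge one12 g1 0; rewrite big_ord0.
exact: Im_logsum1_le.
Qed.

Lemma height_strip_disk z : nrm z < 1 ->
  1 <= complex.Re (height z) /\ `|complex.Im (height z)| <= 4.
Proof. by move=> z1; apply: height_strip; [exact: ltW|exact: disk_notin]. Qed.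

Lemma G_ge1_disk z : nrm z < 1 -> 1 <= complex.Re (G z).
Proof. by move=> z1; apply: G_ge1; [exact: ltW|exact: disk_notin]. Qed.

Lemma hol_height : hol height.
Proof.
apply: holD; first exact: hol_cst.
by apply: hol_logsum => //; exact: G_ge1_disk.
Qed.

Lemma hol_symbol : hol symbol.
Proof.
apply: (@hol_eq _ (fun z => 1 - (height z)^-1)).
  by move=> z z1; rewrite symbol_disk.
apply: holB; first exact: hol_cst.
by apply: hol_inv; [exact: hol_height|move=> z /height_strip_disk[]].
Qed.

Lemma symbol_inside (r : R) : r < 1 ->
  exists2 q, q < 1 & forall z, nrm z <= r -> nrm (symbol z) <= q.
Proof.
move=> r1; have [M M0 hM] := hol_bounded hol_height r1.
pose N := M + 1; have N0 : 0 < N by rewrite addr_gt0.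
exists (Num.sqrt (1 - (N ^+ 2)^-1)).
  have N20 : 0 < (N ^+ 2)^-1 by rewrite invr_gt0 exprn_gt0.
  rewrite -[ltRHS]sqrtr1 ltr_sqrt//.
  by rewrite ltrBlDr ltrDl.
move=> z zr; have z1 := le_lt_trans zr r1; rewrite symbol_disk//.
have [h1 h2] := height_strip_disk z1.
rewrite -[leLHS]ger0_norm ?nrm_ge0// -sqrtr_sqr ler_wsqrtr// lerBrDr -lerBrDl.
apply: le_trans (cusp_defect_ge h1); rewrite lef_pV2 ?posrE ?exprn_gt0//.
  by rewrite lerXn2r ?nnegrE ?nrm_ge0 ?(ltW N0)// (le_trans (hM z zr))// lerDl.
by rewrite (lt_le_trans ltr01)// (le_trans h1)// (le_trans (ler_norm _))// Re_le_nrm.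
Qed.

Lemma nrm_symbol_lt1 z : nrm z <= 1 -> ~ K z -> nrm (symbol z) < 1.
Proof.
move=> z1 Kz; rewrite /symbol asboolF//.
by have [h1 h2] := height_strip z1 Kz; exact: nrm_cusp_lt1.
Qed.

Lemma symbol_continuous c (e : R) : nrm c <= 1 -> 0 < e ->
  exists2 d : R, 0 < d & forall z, nrm z <= 1 -> nrm (z - c) < d ->
    nrm (symbol z - symbol c) <= e.
Proof.
move=> c1 e0; have hn z : nrm z <= 1 -> ~ K z -> 1 <= nrm (height z).
  move=> z1 Kz; have [h1 _] := height_strip z1 Kz.
  by rewrite (le_trans h1)// (le_trans (ler_norm _))// Re_le_nrm.
have [Kc|Kc] := pselect (K c); last first.
  (* Both [cusp] and [logsum 1] are Lipschitz on the relevant regions. *)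
  have [d d0 hd] := G_cont c1 Kc (divr_gt0 e0 (ltr0n R 2)).
  exists d => // z z1 zd; have [Kz Gz] := hd z z1 zd.
  rewrite /symbol !asboolF// (le_trans (cusp_lipschitz _ _)) ?hn//.
  rewrite /height opprD addrACA subrr add0r.
  rewrite (le_trans (logsum1_lipschitz _ _)) ?G_ge1//.
  by move: Gz; lra.
(* [|symbol z - 1|] is the inverse of the modulus of the height, which is at least [n / 4]
   as soon as [|G z|] is at least [2 ^+ n]. *)
pose n := (Num.truncn (4 / e)).+1.
have [d d0 hd] := G_peak (2 ^+ n) Kc.
exists d => // z z1 zd; rewrite {2}/symbol asboolT//.
have [Kz|Kz] := pselect (K z); rewrite /symbol.
  by rewrite asboolT// subrr nrm0 ltW.
rewrite asboolF// /cusp addrAC subrr add0r nrmN nrmV.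
have g1 := G_ge1 z1 Kz.
have gn : 2 ^+ n <= nrm (G z).
  by rewrite (le_trans (hd z z1 Kz zd))// (le_trans (ler_norm _))// Re_le_nrm.
have ne : e^-1 <= n%:R / 4.
  have : 4 / e < n%:R by rewrite /n truncnS_gt.
  by lra.
have := Re_logsum1_large g1 gn => hl.
rewrite -[leRHS]invrK lef_pV2 ?posrE ?invr_gt0//.
  rewrite (le_trans ne)// (le_trans hl)//.
  rewrite (@le_trans _ _ (complex.Re (height z)))//.
    by rewrite /height ReD/= lerDr.
  by rewrite (le_trans (ler_norm _))// Re_le_nrm.
by rewrite (lt_le_trans ltr01)// hn.
Qed.

Lemma symbol_within : {within @closed_disk R, continuous symbol}.
Proof.
apply/subspace_continuousP => c cD A /nbhs_nrmP[e e0 eA].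
have c1 : nrm c <= 1 by move: cD; rewrite /closed_disk/= nrmE (lecR _ 1).
have e20 : 0 < e / 2 by rewrite divr_gt0.
have [d d0 hd] := symbol_continuous c1 e20.
apply/nbhs_nrmP; exists d => // z zd zD.
have z1 : nrm z <= 1 by move: zD; rewrite /closed_disk/= nrmE (lecR _ 1).
by apply: eA; rewrite (le_lt_trans (hd z z1 zd))// ltr_pdivrMr// mulr_natr mulr2n ltrDl.
Qed.

Lemma symbol_radial z : nrm z = 1 -> boundary_value symbol z (symbol z).
Proof.
move=> z1; apply/cvgC_nrm; apply/cvgrPdist_le => e e0.
have z1' : nrm z <= 1 by rewrite z1.
have [d d0 hd] := symbol_continuous z1' e0.
near=> r; rewrite sub0r normrN ger0_norm ?nrm_ge0//.
have r1 : r < 1 by near: r; exact: nbhs_left_lt.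
have r0 : 0 < r by near: r; exact: nbhs_left_gt.
have rd : 1 - d < r by near: r; apply: nbhs_left_gt; rewrite ltrBlDr ltrDl.
apply: hd; first by rewrite nrmM nrm_real_ge0 ?z1 ?mulr1 ltW.
rewrite -[X in _ - X]mul1r -mulrBl nrmM z1 mulr1 nrmBC.
have -> : (1 : C) - r%:C = (1 - r)%:C by rewrite rmorphB.
by rewrite nrm_real_ge0 ?subr_ge0 ?ltW//; lra.
Unshelve. all: by end_near.
Qed.

Lemma symbol_contact_set : contact_set symbol = K.
Proof.
have circleE z : circle z -> nrm z = 1 by rewrite /circle/= nrmE => /complexI.
apply/seteqP; split=> [z [zc [w [zw wc]]]|z Kz].
  have z1 := circleE _ zc.
  have wE : w = symbol z.
    have hC : hausdorff_space C by exact: norm_hausdorff.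
    exact: (cvg_unique hC zw (symbol_radial z1)).
  apply: contrapT => Kz; have : nrm (symbol z) < 1.
    by apply: nrm_symbol_lt1 => //; rewrite z1.
  by rewrite -wE (circleE _ wc) ltxx.
have zc := K_circle Kz; split=> //; exists (symbol z); split.
  exact: symbol_radial (circleE _ zc).
by rewrite /symbol asboolT// /circle/= normr1.
Qed.

End Symbol.

(** * Blaschke products with dyadic zeros *)

Section DyadicBlaschke.
Variable R : realType.
Local Notation C := (Cplx R).
Local Notation nrm := (@Normc.normc R).

Definition dyadic_zeros (k m : nat) : seq R :=
  flatten [seq nseq m (1 - (2 ^+ i)^-1) | i <- iota 0 k].

Lemma size_dyadic_zeros k m : size (dyadic_zeros k m) = (k * m)%N.
Proof.
rewrite /dyadic_zeros size_flatten /shape -map_comp sumnE big_map.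
under eq_bigr do rewrite /= size_nseq.
by rewrite big_const_seq count_predT size_iota iter_addn_0 mulnC.
Qed.

Lemma dyadic_zero_itv i : 0 <= 1 - ((2 : R) ^+ i)^-1 < 1.
Proof.
rewrite subr_ge0 ltrBlDr ltrDl invr_gt0 exprn_gt0// andbT.
by rewrite invf_le1 ?exprn_gt0// exprn_ege1// ler1n.
Qed.

Lemma dyadic_zeros_itv k m : {in dyadic_zeros k m, forall r, 0 <= r < 1}.
Proof.
by move=> r /flatten_mapP[i _ /nseqP[-> _]]; exact: dyadic_zero_itv.
Qed.

Lemma dyadic_block (x : R) k : 1 <= x -> x <= 2 ^+ k.+1 ->
  exists2 i, (i < k.+1)%N & 2 ^+ i <= x <= 2 * 2 ^+ i.
Proof.
move=> x1; elim: k => [|k ih] xk.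
  by exists 0%N => //; rewrite expr0 x1 mulr1 -[leRHS]expr1.
have [/ih[i ik ix]|/ltW kx] := leP x (2 ^+ k.+1); first by exists i => //; exact: leqW.
by exists k.+1 => //; rewrite kx -exprS.
Qed.

(** The block that contains the height contributes [m] small factors. *)
Lemma dyadic_blaschke_le k m (l : C) :
    1 <= complex.Re l -> `|complex.Im l| <= 4 -> complex.Re l <= 2 ^+ k.+1 ->
  nrm (blaschke_product (dyadic_zeros k.+1 m) (cusp l)) ^+ 2 <= (24 / 25) ^+ m.
Proof.
move=> l1 l4 lk; have [i ik ilx] := dyadic_block l1 lk.
have w1 := nrm_cusp_lt1 l1.
rewrite /blaschke_product /dyadic_zeros big_flatten big_map.
under eq_bigr do rewrite big_nseq iter_mulr_1.
rewrite (bigD1_seq i) ?iota_uniq ?mem_iota//= nrmM nrmX exprMn exprAC.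
rewrite -[leRHS]mulr1 ler_pM ?exprn_ge0 ?sqr_ge0 ?nrm_ge0//.
  rewrite lerXn2r ?nnegrE ?sqr_ge0//.
  apply: nrm_blaschke_cusp_le => //.
  by rewrite exprn_ege1// ler1n.
rewrite expr_le1 ?nrm_ge0//.
apply: (big_ind (fun x => nrm x <= 1)) => [|x y x1 y1|j _].
- by rewrite nrm1.
- by rewrite nrmM mulr_ile1 ?nrm_ge0.
by rewrite nrmX exprn_ile1 ?nrm_ge0// nrm_blaschke_le1// dyadic_zero_itv.
Qed.

End DyadicBlaschke.

(** * The rate of decay and its summability *)

Section DecayRates.
Variable R : realType.

Lemma ln_nat_gt0 n : (2 <= n)%N -> 0 < ln n%:R :> R.
Proof. by move=> n2; rewrite ln_gt0// ltr1n. Qed.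

Lemma geometric_decay (q c : R) (n k : nat) : 0 < q < 1 -> (2 <= n)%N ->
    c * (n%:R / ln n%:R) <= k.+1%:R ->
  q ^+ k <= q^-1 * expR (- (- ln q * c) * (n%:R / ln n%:R)).
Proof.
move=> /andP[q0 q1] n2 h; rewrite ler_pdivlMl// -exprS.
rewrite -[q in leLHS]lnK// -expRM_natl ler_expR.
move: (n%:R / _) h => y h.
rewrite [leRHS](_ : _ = ln q * (c * y)); last by ring.
by rewrite mulrC ler_nM2l// ln_lt0// q0.
Qed.

Lemma up_log_le n : (2 <= n)%N -> (up_log 2 n)%:R * ln 2 <= 2 * ln n%:R :> R.
Proof.
move=> n2; have /andP[+ _] := up_log_bounds (ltnSn 1) n2.
set k := up_log 2 n; have k0 : (0 < k)%N by rewrite /k up_log_gt0.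
move=> kn; have ln2 : ln 2 <= ln n%:R :> R.
  by rewrite ler_ln ?posrE ?ltr0n ?ler_nat// (leq_trans _ n2).
have : ln ((2 ^ k.-1)%:R) <= ln n%:R :> R.
  by rewrite ler_ln ?posrE ?ltr0n ?expn_gt0 ?ler_nat ?(ltnW kn)// (leq_trans _ n2).
rewrite natrX lnXn// -(mulr_natl (ln _)) => h.
have -> : k%:R = k.-1%:R + 1 :> R by rewrite natr1 prednK.
by rewrite mulrDl mul1r; lra.
Qed.

Lemma ln_le_sqrt n : (2 <= n)%N -> Num.sqrt n%:R / 2 <= n%:R / ln n%:R :> R.
Proof.
move=> n2; have n0 : 0 < n%:R :> R by rewrite ltr0n (leq_trans _ n2).
have s0 : 0 < Num.sqrt n%:R :> R by rewrite sqrtr_gt0.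
have l0 := ln_nat_gt0 n2.
have e : n%:R = Num.sqrt n%:R ^+ 2 :> R by rewrite sqr_sqrtr// ltW.
have : ln n%:R <= 2 * Num.sqrt n%:R :> R.
  by rewrite {1}e lnXn// -(mulr_natl (ln _)) ler_pM2l// ltW// ln_sublinear.
rewrite ler_pdivlMr// => h; rewrite [leRHS]e.
by move: s0 h; move: (Num.sqrt _) (ln _) => s l; nra.
Qed.

(** Since [n / ln n] dominates [sqrt n], the exponential decays faster than
    any power of [n]; the form of the bound makes its sum telescope. *)
Lemma rate_summable (c : R) : 0 < c -> exists2 B, 0 <= B & forall n, (2 <= n)%N ->
  expR (- c * (n%:R / ln n%:R)) <= B / (n%:R * n.+1%:R).
Proof.
move=> c0; pose B := 24 * (2 / c) ^+ 4.
have B0 : 0 <= B by rewrite mulr_ge0// exprn_ge0// divr_ge0// ltW.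
exists (2 * B); first exact: mulr_ge0.
move=> n n2; have n0 : 0 < n%:R :> R by rewrite ltr0n (leq_trans _ n2).
have s0 : 0 < Num.sqrt n%:R :> R by rewrite sqrtr_gt0.
pose t : R := c * (Num.sqrt n%:R / 2).
have t0 : 0 < t by rewrite mulr_gt0// divr_gt0.
apply: (@le_trans _ _ (expR (- t))).
  by rewrite ler_expR mulNr lerN2 ler_pM2l// ln_le_sqrt.
apply: (@le_trans _ _ (24 / t ^+ 4)).
  rewrite expRN -[leRHS]invf_div lef_pV2 ?posrE ?expR_gt0 ?divr_gt0 ?exprn_gt0//.
  have := expR_ge1Dxn 3 (ltW t0); rewrite (_ : 4`!%:R = 24 :> R)//.
  by apply: le_trans; rewrite lerDr.
have -> : 24 / t ^+ 4 = B / n%:R ^+ 2.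
  have e : Num.sqrt n%:R ^+ 4 = n%:R ^+ 2 :> R.
    by rewrite (exprM _ 2 2) sqr_sqrtr// ltW.
  rewrite /t /B -e; have := gt_eqF s0; move: (Num.sqrt _) => s sn.
  by field; rewrite sn (gt_eqF c0).
rewrite -[leRHS]mulrA [leRHS]mulrCA ler_wpM2l//.
rewrite ler_pdivlMr ?mulr_gt0 ?n0 ?ltr0n// ler_pdivrMl ?exprn_gt0//.
have h : n.+1%:R <= 2 * n%:R :> R by rewrite -natrM ler_nat; lia.
by rewrite expr2 -mulrA ler_pM2l// mulrC.
Qed.

End DecayRates.

Section Schatten.
Variable R : realType.
Local Notation H2 := (H2 R).

Lemma approximation_number_ge0 n (T : H2 -> H2) :
  (0 <= approximation_number n T)%E.
Proof.
apply: le_ereal_inf_tmp => _ [S _ <-].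
have h0 : hnorm (0 : H2) <= 1.
  apply: (@le_trans _ _ 0) => //; apply: hnorm_le => // n'.
  have -> : taylor_coef (0 : H2) = fun=> 0.
    apply: taylor_coef_eq => z _; rewrite (_ : series _ = fun=> 0); first exact: cvg_cst.
    by apply/funext => j; rewrite /series/= big1// => i _; rewrite mul0r.
  by rewrite big1 ?expr0n// => k _; rewrite nrm0 expr0n.
apply: (@le_trans _ _ (hnorm (T 0 - S 0))%:E); first by rewrite lee_fin hnorm_ge0.
by apply: ereal_sup_ubound; exists 0.
Qed.

Lemma schatten_of_rate (T : H2 -> H2) (a b a1 p : R) : 0 <= a -> 0 < b -> 0 < p ->
    (approximation_number 1 T <= a1%:E)%E ->
    (forall n, (2 <= n)%N -> (approximation_number n T <=
       (a * expR (- b * (n%:R / ln n%:R)))%:E)%E) ->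
  schatten p T.
Proof.
move=> a0 b0 p0 T1 Tn.
have a10 : 0 <= a1 by rewrite -lee_fin (le_trans (approximation_number_ge0 1 T)).
have [B B0 hB] := @rate_summable R (b * p) (mulr_gt0 b0 p0).
pose M := 2 * a1 `^ p + a `^ p * B.
have M0 : 0 <= M by rewrite addr_ge0// mulr_ge0// powR_ge0.
have pow_le n (y : R) : 0 <= y -> (approximation_number n T <= y%:E)%E ->
    (poweR (approximation_number n T) p <= (y `^ p)%:E)%E.
  move=> y0 h; rewrite -poweR_EFin; apply: gt0_ler_poweR => //; first exact: ltW.
    by rewrite in_itv/= approximation_number_ge0 leey.
  by rewrite in_itv/= lee_fin y0 leey.
have term n : (1 <= n)%N -> (poweR (approximation_number n T) p <=
    (M / (n%:R * n.+1%:R))%:E)%E.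
  rewrite leq_eqVlt => /predU1P[<-|n2].
    apply: (le_trans (pow_le _ _ a10 T1)); rewrite lee_fin mul1r ler_pdivlMr//.
    by rewrite /M mulrC lerDl mulr_ge0// powR_ge0.
  have y0 : 0 <= a * expR (- b * (n%:R / ln n%:R)) by rewrite mulr_ge0 ?expR_ge0.
  apply: (le_trans (pow_le _ _ y0 (Tn n n2))); rewrite lee_fin.
  rewrite powRM ?expR_ge0// -expRM mulrAC.
  have := hB n n2; rewrite -mulNr => h.
  apply: (@le_trans _ _ (a `^ p * (B / (n%:R * n.+1%:R)))).
    by rewrite ler_wpM2l ?powR_ge0// -[- b * p]mulNr.
  by rewrite mulrA ler_wpM2r ?invr_ge0 ?mulr_ge0// lerDr mulr_ge0 ?powR_ge0.
rewrite /schatten; apply: (@le_lt_trans _ _ M%:E); last exact: ltry.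
apply: lime_le.
  by apply: is_cvg_nneseries => n _ _; exact: poweR_ge0.
apply: nearW => N.
apply: (@le_trans _ _ (\sum_(1 <= n < N) (M / (n%:R * n.+1%:R))%:E)%E).
  by rewrite big_nat_cond [leRHS]big_nat_cond; apply: lee_sum => n /andP[/andP[n1 _] _]; exact: term.
rewrite sumEFin lee_fin.
have [N1|N1] := leqP N 1; first by rewrite big_geq.
have e n : (1 <= n < N)%N -> M / (n%:R * n.+1%:R) = (- (M / n.+1%:R)) - (- (M / n%:R)).
  move=> /andP[n1 _]; have n0 : (n%:R : R) != 0 by rewrite pnatr_eq0 -lt0n.
  have n0' : (n.+1%:R : R) != 0 by rewrite pnatr_eq0.
  by rewrite -natr1 in n0' *; field; rewrite n0 n0'.
rewrite (eq_big_nat _ _ e) (telescope_sumr (fun n => - (M / n%:R)) (ltnW N1)).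
rewrite opprK divr1 addrC gerBl.
by rewrite divr_ge0.
Qed.

End Schatten.

(** * Decay of the approximation numbers *)

Section DecayOfSymbol.
Variable R : realType.
Local Notation C := (Cplx R).
Local Notation H2 := (H2 R).
Local Notation nrm := (@Normc.normc R).
Variables (K : set C) (G : C -> C).
Hypothesis K_circle : K `<=` @circle R.
Hypothesis G_hol : hol G.
Hypothesis G_ge1 : forall z, nrm z <= 1 -> ~ K z -> 1 <= complex.Re (G z).
Let psi := symbol K G.
(* The constant comes from [cusp_kernel_le]. *)
Let s0 (z : C) : C := (17 : R)%:C * height G z.

Lemma symbol_majorant_hol : hol s0.
Proof. by apply: holZ; exact: hol_height K_circle G_hol G_ge1. Qed.

Lemma symbol_majorant z : nrm z < 1 ->
  1 <= complex.Re (s0 z) * (1 - nrm (psi z) ^+ 2).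
Proof.
move=> z1; have [h1 h2] := height_strip_disk K_circle G_ge1 z1.
by rewrite /psi symbol_disk// /s0 ReZ; exact: cusp_kernel_le.
Qed.

Lemma symbol_lt1 z : nrm z < 1 -> nrm (psi z) < 1.
Proof. move=> z1; exact (psi_lt1 (symbol_inside K_circle G_hol G_ge1) z1). Qed.

Lemma symbol_defect_ge0 z : nrm z < 1 -> 0 <= 1 - nrm (psi z) ^+ 2.
Proof.
move=> z1; rewrite subr_ge0 expr_le1 ?nrm_ge0//.
exact/ltW/symbol_lt1.
Qed.

Variable Cpsi : {linear H2 -> H2}.
Hypothesis Cpsi_comp : is_composition_operator psi Cpsi.

Let three_halves : 1 <= (3 / 2 : R) < 2.
Proof. by apply/andP; split; lra. Qed.

(** Where the height has real part at most [2 ^+ k.+1], the Blaschke product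
    with an [m]-fold zero for each of the [k.+1] dyadic blocks is small.
    Elsewhere the real part exceeds [n], and it is at most [4 * (3 / 2) ^- p]
    times that of [logsum (3 / 2) (G z)], by [Re_logsum1_le]. *)
Lemma symbol_approximation_number n k m p : (2 <= n)%N -> (n <= 2 ^ k.+1)%N ->
    (k.+1 * m < n)%N -> (p * 4 <= n)%N ->
  (approximation_number n Cpsi <= (Num.sqrt (17 * ((24 / 25) ^+ m * complex.Re (height G 0) +
     4 * (3 / 2) ^- p * complex.Re (logsum (3 / 2) (G 0)))))%:E)%E.
Proof.
move=> n2 nk kmn pn.
have q0 : 0 <= (24 / 25 : R) by lra.
pose s (z : C) : C := (17 : R)%:C * (((24 / 25 : R) ^+ m)%:C * height G z +
  (4 * (3 / 2 : R) ^- p)%:C * logsum (3 / 2) (G z)).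
have hs : hol s.
  apply: holZ; apply: holD; apply: holZ.
    exact: hol_height K_circle G_hol G_ge1.
  exact: hol_logsum three_halves G_hol (G_ge1_disk K_circle G_ge1).
have ReS z : complex.Re (s z) = 17 * ((24 / 25) ^+ m * complex.Re (height G z) +
    4 * (3 / 2) ^- p * complex.Re (logsum (3 / 2) (G z))).
  by rewrite /s ReZ ReD !ReZ.
rewrite -ReS.
apply: (approximation_number_le (hol_symbol K_circle G_hol G_ge1)
  (symbol_inside K_circle G_hol G_ge1) Cpsi_comp symbol_majorant_hol
  symbol_majorant (rs := dyadic_zeros R k.+1 m)) => //.
- exact: dyadic_zeros_itv.
- by rewrite size_dyadic_zeros.
move=> z z1; have [h1 h2] := height_strip_disk K_circle G_ge1 z1.
have d0 := symbol_defect_ge0 z1; have major := symbol_majorant z1.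
have g1 := G_ge1_disk K_circle G_ge1 z1.
have xp0 : 0 <= (3 / 2 : R) ^- p by rewrite invr_ge0 exprn_ge0//; lra.
have L0 : 0 <= complex.Re (logsum (3 / 2) (G z)).
  by have := Re_logsum_ge three_halves g1 0; rewrite big_ord0.
have qm0 : 0 <= (24 / 25 : R) ^+ m by rewrite exprn_ge0.
set X := complex.Re (height G z) in h1 *.
have X0 : 0 <= X by apply: le_trans h1.
have major' : 1 <= 17 * X * (1 - nrm (psi z) ^+ 2).
  by move: major; rewrite /s0 ReZ.
rewrite ReS -/X (mulrDr 17).
set U := 17 * ((24 / 25) ^+ m * X); set V := 17 * (4 * _ * _).
set d := 1 - nrm (psi z) ^+ 2 in d0 major major' *; rewrite (mulrDl U V d).
have V0 : 0 <= V by rewrite /V; apply: mulr_ge0 => //; apply: mulr_ge0 => //; exact: mulr_ge0.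
have U0 : 0 <= U by rewrite /U; apply: mulr_ge0 => //; exact: mulr_ge0.
have [Xk|kX] := leP X (2 ^+ k.+1).
  rewrite ler_wpDr//; first exact: mulr_ge0.
  apply: (@le_trans _ _ ((24 / 25) ^+ m)).
    by rewrite /psi symbol_disk//; exact: dyadic_blaschke_le.
  by rewrite /U mulrCA -mulrA ler_peMr.
rewrite ler_wpDl//; first exact: mulr_ge0.
apply: (@le_trans _ _ 1).
  apply: exprn_ile1; first exact: nrm_ge0.
  apply: nrm_blaschke_product_le1; first exact: dyadic_zeros_itv.
  exact: symbol_lt1.
apply: (le_trans major'); rewrite ler_wpM2r// ler_pM2l//.
(* As [1 + p <= 3 / 4 * X], [Re_logsum1_le] absorbs three quarters of [X]. *)
have nX : n%:R <= X.
  by rewrite (le_trans _ (ltW kX))// -natrX ler_nat.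
have XE : X = 1 + complex.Re (logsum 1 (G z)) by rewrite /X /height ReD.
have := Re_logsum1_le g1 p three_halves.
have n2' : 2 <= n%:R :> R by rewrite ler_nat.
have pn' : p%:R * 4 <= n%:R :> R by rewrite -natrM ler_nat.
rewrite -mulrA; move: (_ ^- p * _) => y.
by move: XE nX n2' pn'; move: (complex.Re (logsum 1 _)) => u; lra.
Qed.

(** About [log n] blocks with zeros of order about [n / log n] exhaust the
    allowed rank. *)
Lemma symbol_decay : exists a b : R, [/\ 0 < a, 0 < b & forall n, (2 <= n)%N ->
  (approximation_number n Cpsi <= (a * expR (- b * (n%:R / ln n%:R)))%:E)%E].
Proof.
pose q : R := 24 / 25; have q01 : 0 < q < 1 by rewrite /q; apply/andP; split; lra.
have [q0 q1] := andP q01.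
pose c : R := ln 2 / 4; have ln2 : 0 < ln 2 :> R by rewrite ln_gt0// ltr1n.
have c0 : 0 < c by rewrite divr_gt0.
pose b := - ln q * c; have b0 : 0 < b by rewrite mulr_gt0// oppr_gt0 ln_lt0.
have z01 : nrm (0 : C) < 1 by rewrite nrm0.
pose A := complex.Re (height G 0); pose D := complex.Re (logsum (3 / 2) (G 0)).
have A1 : 1 <= A by have [] := height_strip_disk K_circle G_ge1 z01.
have D0 : 0 <= D.
  by have := Re_logsum_ge three_halves (G_ge1_disk K_circle G_ge1 z01) 0; rewrite big_ord0.
pose E := 17 * (A + 4 * D) / q.
have E0 : 0 < E by rewrite divr_gt0// mulr_gt0//; lra.
exists (Num.sqrt E), (b / 2); split; [by rewrite sqrtr_gt0|by rewrite divr_gt0|].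
move=> n n2; pose k := (up_log 2 n).-1; pose m := (n.-1 %/ k.+1)%N; pose p := (n %/ 4)%N.
have kE : k.+1 = up_log 2 n by rewrite /k prednK// up_log_gt0.
have n0 : (0 < n)%N by apply: leq_trans n2.
have nk : (n <= 2 ^ k.+1)%N by rewrite kE up_logP.
have kmn : (k.+1 * m < n)%N.
  by rewrite mulnC (leq_ltn_trans (leq_trunc_div _ _))// prednK.
have pn : (p * 4 <= n)%N by exact: leq_trunc_div.
apply: (le_trans (symbol_approximation_number n2 nk kmn pn)).
have l0 := @ln_nat_gt0 R n n2.
set y := n%:R / ln n%:R.
have ym : c * y <= m.+1%:R.
  have h : (n <= m.+1 * k.+1)%N.
    by have := ltn_ceil n.-1 (ltn0Sn k); rewrite -/m prednK.
  rewrite /y mulrA ler_pdivrMr//.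
  have : n%:R <= m.+1%:R * k.+1%:R :> R by rewrite -natrM ler_nat.
  move=> /(ler_wpM2r (ltW ln2)) h1.
  have := @up_log_le R n n2; rewrite -kE => h2.
  have : m.+1%:R * (k.+1%:R * ln 2) <= m.+1%:R * (2 * ln n%:R) :> R by rewrite ler_wpM2l.
  have : 0 <= m.+1%:R * ln n%:R :> R by rewrite mulr_ge0// ltW.
  by move: h1; rewrite /c -!mulrA; lra.
have yp : c * y <= p.+1%:R.
  have h : (n <= p.+1 * 4)%N by exact: ltnW (ltn_ceil n (ltn0Sn 3)).
  have h1 : n%:R <= p.+1%:R * 4 :> R by rewrite -natrM ler_nat.
  have ln2n : ln 2 <= ln n%:R :> R by rewrite ler_ln ?posrE ?ltr0n ?ler_nat.
  rewrite /y mulrA ler_pdivrMr// /c.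
  have : n%:R * ln 2 <= n%:R * ln n%:R :> R by rewrite ler_wpM2l.
  have : n%:R * ln n%:R <= p.+1%:R * 4 * ln n%:R :> R by rewrite ler_wpM2r// ltW.
  by lra.
have Qm := geometric_decay q01 n2 ym; have Qp := geometric_decay q01 n2 yp.
rewrite -/b -/y in Qm Qp.
have xq : (3 / 2 : R) ^- p <= q ^+ p.
  by rewrite -exprVn lerXn2r ?nnegrE ?invr_ge0 ?(ltW q0)//; rewrite /q; lra.
rewrite lee_fin -/A -/D -/q.
apply: (@le_trans _ _ (Num.sqrt (E * expR (- b * y)))).
  apply: ler_wsqrtr; set P := q^-1 * expR (- b * y) in Qm Qp.
  have -> : E * expR (- b * y) = 17 * (P * A + 4 * (P * D)).
    by rewrite /E /P; move: (q^-1) (expR _) => i e; ring.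
  have : q ^+ m * A <= P * A by rewrite ler_wpM2r// (le_trans ler01).
  have : (3 / 2) ^- p * D <= P * D by rewrite ler_wpM2r// (le_trans xq).
  by move: (q ^+ m) (_ ^- p) (P) => u v w; lra.
rewrite sqrtrM ?(ltW E0)// ler_wpM2l ?sqrtr_ge0//.
have -> : - b * y = (- (b / 2) * y) * 2%:R by field.
by rewrite expRM_natr sqrtr_sqr ger0_norm ?expR_ge0.
Qed.

End DecayOfSymbol.

Theorem theorem5p3 (R : realType) (K : set (Cplx R))
    (K_compact : compact K) (K_circle : K `<=` @circle R)
    (K_negligible : circle_negligible K) :
  exists psi : Cplx R -> Cplx R,
    [/\ schur psi, disk_algebra psi, contact_set psi = K,
        (forall z, K z -> psi z = 1) &
        exists Cpsi : {linear H2 R -> H2 R},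
          [/\ is_composition_operator psi Cpsi,
              bounded_operator Cpsi,
              (exists a b : R, [/\ 0 < a, 0 < b &
                 forall n : nat, (2 <= n)%N ->
                   (approximation_number n Cpsi
                      <= (a * expR (- b * (n%:R / ln n%:R)))%:E)%E]) &
              (forall p : R, 0 < p -> schatten p Cpsi)]].
Proof.
have [G [G_hol G_ge1 G_cont G_peak]] := peak_function K_compact K_circle K_negligible.
have psi_hol := hol_symbol K_circle G_hol G_ge1.
have psi_in := symbol_inside K_circle G_hol G_ge1.
have analytic : analytic_on_disk (symbol K G).
  by move=> z /diskE; exact: hol_derivable.
exists (symbol K G); split.
- by split=> // z /diskE z1; apply/diskE; exact (psi_lt1 psi_in z1).
- by split=> //; exact (symbol_within G_ge1 G_cont G_peak).
- exact: symbol_contact_set K_circle G_ge1 G_cont G_peak.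
- by move=> z Kz; rewrite /symbol asboolT.
have s0_hol := symbol_majorant_hol K_circle G_hol G_ge1.
have s0_major := symbol_majorant K_circle G_ge1.
have [|Cpsi CpsiE _] := weighted_composition psi_hol psi_in (@hol_cst R 1) s0_hol.
  by move=> z z1; rewrite nrm1 expr1n; exact: s0_major.
have Cpsi_comp : is_composition_operator (symbol K G) Cpsi.
  by move=> f z /diskE z1; rewrite CpsiE// mul1r.
have [a [b [a0 b0 hab]]] := symbol_decay K_circle G_hol G_ge1 Cpsi_comp.
exists Cpsi; split=> //.
- exact (composition_bounded psi_hol psi_in Cpsi_comp s0_hol s0_major).
- by exists a, b.
move=> p p0; apply: schatten_of_rate (ltW a0) b0 p0 _ hab.
apply: (approximation_number_le psi_hol psi_in Cpsi_comp s0_hol s0_major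
  (rs := [::]) _ _ s0_hol) => // z z1.
by rewrite /blaschke_product big_nil nrm1 expr1n; exact: s0_major.
Qed.
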